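(* Fix a finite-range, translation-invariant, commuting interaction of bounded interaction strength on $\mathbb{Z}$ with local dimension $d$, and let $\beta>0$. For $n\ge 2$ let $\Lambda=\{1,\dots,n\}$, let $H_\Lambda$ be the associated Hamiltonian and let $\sigma^\Lambda=e^{-\beta H_\Lambda}/\mathrm{tr}[e^{-\beta H_\Lambda}]$ be its Gibbs state. Then $\sigma^\Lambda$ satisfies a transportation-cost inequality with constant $C=\mathcal{O}(n\,\mathrm{polylog}(n))$; that is, there is $C_n=\mathcal{O}(n\,\mathrm{polylog}(n))$ such that for all $n\ge2$ and all $\rho\in\mathcal{D}(\mathcal{H}_\Lambda)$, $$W_1(\rho,\sigma^\Lambda)\le\sqrt{C_n\,D(\rho\|\sigma^\Lambda)}.$$
   Context: Notation. $\mathcal{H}_\Lambda=\bigotimes_{k\in\Lambda}\mathcal{H}_k$ with $\mathcal{H}_k\cong\mathbb{C}^d$; $\mathcal{D}(\mathcal{H})$ is the set of density operators on $\mathcal{H}$, $D(\rho\|\sigma)=\mathrm{tr}(\rho\ln\rho-\rho\ln\sigma)$ the relative entropy. $\mathcal{O}(n\,\mathrm{polylog}(n))$ means bounded by $c\,n(\ln n)^{c'}$ with $c,c'$ independent of $n$. Hamiltonian. An interaction assigns to each finite $A\subset\mathbb{Z}$ a self-adjoint operator $h_A$ acting on the sites in $A$; $H_\Lambda=\sum_{A\subset\Lambda}h_A$. Finite range $r$: $h_A=0$ whenever $\max A-\min A>r$. Commuting: $[h_A,h_{A'}]=0$ for all $A,A'$. Translation-invariant: $h_{A+k}=h_A$ (under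 the natural identification) for all finite $A\subset\mathbb{Z}$ and $k\in\mathbb{Z}$. The range $r$ and the interaction strength $J=\max_A\|h_A\|_\infty$ do not depend on $n$. Quantum Wasserstein distance. For $H=H^\dagger\in\mathcal{B}(\mathcal{H}_\Lambda)$, the Lipschitz constant is $$\|H\|_L:=2\max_{i\in\{1,\dots,n\}}\min\big\{\|H-H^{(i)}\|_\infty:\ H^{(i)}=(H^{(i)})^\dagger\text{ does not act on the }i\text{-th qudit}\big\},$$ and for states $\rho,\sigma$, $W_1(\rho,\sigma):=\max\{\mathrm{tr}[(\rho-\sigma)H]:\ H=H^\dagger,\ \|H\|_L\le1\}$. *)

(* Defs.v *)
From HB Require Import structures.
From mathcomp Require Import all_boot all_order all_algebra.
From mathcomp Require Import finmap.
From mathcomp Require Export complex.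
From mathcomp Require Import all_classical reals sequences exp.

Set Implicit Arguments.
Unset Strict Implicit.
Unset Printing Implicit Defensive.

Import Order.TTheory GRing.Theory Num.Theory.
Local Open Scope classical_set_scope.
Local Open Scope fset_scope.
Local Open Scope sesquilinear_scope.
Local Open Scope complex_scope.
Local Open Scope ring_scope.

Section Matrices.
Variable R : realType.

Definition l2norm n (v : 'cV[R[i]]_n) : R :=
  Num.sqrt (\sum_i Normc.normc (v i 0) ^+ 2).

(* The norm written with subscript infinity: the operator (spectral) norm, not
   the entrywise maximum that is MathComp-Analysis' `|A|. *)
Definition opnorm n (A : 'M[R[i]]_n) : R :=
  sup [set l2norm (A *m v) | v in [set v | l2norm v <= 1]].

(* f(A), by the spectral theorem, for Hermitian A: the spectral data satisfy
   A = P^-1 *m diag_mx D *m P with P unitary and D real. *)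
Definition herm_fun (f : R -> R) n (A : 'M[R[i]]_n) : 'M[R[i]]_n :=
  let P := spectralmx A in
  invmx P *m diag_mx (map_mx (fun z => (f (complex.Re z))%:C) (spectral_diag A))
    *m P.

Definition psd n (A : 'M[R[i]]_n) : Prop :=
  forall v : 'cV[R[i]]_n, 0 <= (v ^t* *m A *m v) 0 0.

Definition density n (rho : 'M[R[i]]_n) : Prop :=
  [/\ rho \is hermsymmx, psd rho & \tr rho = 1].

(* tr (rho ln rho - rho ln sigma), which is the relative entropy when the
   support of rho lies in that of sigma, for instance when sigma has full rank
   as every Gibbs state does. As ln 0 = 0 here, the convention 0 ln 0 = 0 is
   built in. *)
Definition rel_entropy n (rho sigma : 'M[R[i]]_n) : R :=
  complex.Re (\tr (rho *m herm_fun (@ln R) rho - rho *m herm_fun (@ln R) sigma)).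

Definition gibbs (beta : R) n (H : 'M[R[i]]_n) : 'M[R[i]]_n :=
  let E := herm_fun (@expR R) (- (beta%:C *: H)) in (\tr E)^-1 *: E.

End Matrices.

(* Operators on the tensor product of copies of C^d indexed by the sites
   x : T, as matrices in the product basis, which is indexed by the
   configurations {ffun T -> 'I_d}. *)
Definition op (R : realType) (d : nat) (T : finType) : Type :=
  'M[R[i]]_#|{ffun T -> 'I_d}|.

(* For an injective f : S -> T, the operator X moved to the sites f @: S and
   tensored with the identity on the other sites of T. *)
Definition embed (R : realType) (d : nat) (S T : finType) (f : S -> T)
    (X : op R d S) : op R d T :=
  \matrix_(a, b)
    let s : {ffun T -> 'I_d} := enum_val a in
    let t : {ffun T -> 'I_d} := enum_val b in
    if [forall y, (y \notin codom f) ==> (s y == t y)]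
    then X (enum_rank [ffun x => s (f x)]) (enum_rank [ffun x => t (f x)])
    else 0.

Section Wasserstein.
Variables (R : realType) (d : nat) (T : finType).

Definition not_acting_on (i : T) (X : op R d T) : Prop :=
  exists Y : op R d {j : T | j != i}, X = embed val Y.

(* The inf is attained, and so is the sup in W1 when rho and sigma have the
   same trace. *)
Definition lip_const (H : op R d T) : R :=
  2 * \big[Num.max/0]_(i : T)
    inf [set opnorm (H - X) |
          X in [set X : op R d T | X \is hermsymmx /\ not_acting_on i X]].

Definition W1 (rho sigma : op R d T) : R :=
  sup [set complex.Re (\tr ((rho - sigma) *m H)) |
        H in [set H : op R d T | H \is hermsymmx /\ lip_const H <= 1]].

End Wasserstein.

Section Interactions.
Variables (R : realType) (d : nat).

Definition interaction := forall A : {fset int}, op R d A.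

Definition translate (k : int) (A : {fset int}) : {fset int} :=
  [fset x + k | x in A].

Lemma translate_subproof (k : int) (A : {fset int}) (x : A) :
  val x + k \in translate k A.
Proof. by apply/imfsetP; exists (val x) => //; exact: valP. Qed.

Definition translate_site (k : int) (A : {fset int}) (x : A) : translate k A :=
  [` translate_subproof k x].

Lemma subset_subproof (L : {fset int}) (A : fpowerset L) : val A `<=` L.
Proof. by rewrite -fpowersetE; exact: valP. Qed.

Definition hamiltonian (h : interaction) (L : {fset int}) : op R d L :=
  \sum_(A : fpowerset L) embed (fincl (subset_subproof A)) (h (val A)).

Definition self_adjoint (h : interaction) : Prop :=
  forall A, h A \is hermsymmx.

(* Some x, y in A have y - x > r exactly when max A - min A > r. *)
Definition finite_range (r : nat) (h : interaction) : Prop :=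
  forall A : {fset int},
    (exists x y, [/\ x \in A, y \in A & r%:Z < y - x]) -> h A = 0.

Definition commuting (h : interaction) : Prop :=
  forall A B : {fset int},
    comm_mx (embed (fincl (fsubsetUl A B)) (h A))
            (embed (fincl (fsubsetUr A B)) (h B)).

Definition translation_invariant (h : interaction) : Prop :=
  forall (A : {fset int}) (k : int),
    h (translate k A) = embed (@translate_site k A) (h A).

Definition strength_le (J : R) (h : interaction) : Prop :=
  forall A, opnorm (h A) <= J.

End Interactions.

Definition chain (n : nat) : {fset int} := [fset k%:Z | k in iota 1 n].

Definition O_n_polylog (R : realType) (C : nat -> R) : Prop :=
  exists c c' : R, forall n, (2 <= n)%N ->
    0 <= C n <= c * n%:R * ln n%:R `^ c'.

(* Main.v *)
(* Let sigma be the Gibbs state. For an interval B of sites let N_B be the algebra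
   of operators that commute with all operators on B and with every interaction
   term meeting B. With M_B = exp (- beta * sum of the terms meeting B) and P_B
   the orthogonal projection on N_B, the map E_B X = P_B (M_B X) P_B (M_B)^-1 is
   the sigma-preserving conditional expectation on N_B, with dual
   E_B* rho = M_B P_B (rho) P_B (M_B)^-1, and the relative entropy splits exactly:
   D (rho || sigma) = D (rho || E_B* rho) + D (E_B* rho || sigma).
   Sweep B over the n windows [k, k + l), with l of order ln n. Each step changes
   the state on O (l) sites only, so by a Pinsker inequality it costs
   O (l) sqrt (D_k) in Wasserstein distance, where the D_k add up to at most
   D (rho || sigma); by Cauchy and Schwarz the sweep costs O (l sqrt (n D)).
   The sweep ends close to sigma: resampling a window of r more sites dominates a
   fixed multiple of an expectation with values in the algebra of the half-line,
   because cutting the bonds at one point perturbs the Boltzmann weight by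
   bounded factors, so a Doeblin argument gives exponential contraction in l. *)

(* The entropy splits exactly because the terms commute: those that do not meet B lie in N_B, so
   sigma = M_B W with W in N_B, while M_B commutes with N_B. The obstacle is a contraction rate that
   does not depend on n. On observables the windows are swept from right to left, so an observable
   that reaches the window at k is, up to a small error, already in the algebra of the half-line
   from k + 1. Only the right end of the window matters then, and the number of terms across the cut
   there is bounded in terms of r alone. An additive error at the end of the sweep would be useless
   for small D. Invariance of sigma turns the remaining difference into the pairing of rho - sigma
   with a small observable, and Pinsker's inequality applies once more. The observable has norm at
   most 2 n up to a scalar and n window errors add up, so a contraction by n^-2 suffices; this is
   why l is of order ln n. Every Pinsker bound is kept in the form c (t D + 1 / t) with a common t,
   so that the entropies add up; t is chosen at the very end. *)
Require Import Defs.
From mathcomp Require Import all_boot all_order all_algebra.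
From mathcomp Require Import finmap.
From mathcomp Require Import all_classical reals sequences exp.
From mathcomp Require Import ring lra zify.

Set Implicit Arguments.
Unset Strict Implicit.
Unset Printing Implicit Defensive.

Import Order.TTheory GRing.Theory Num.Theory.
Local Open Scope classical_set_scope.
Local Open Scope sesquilinear_scope.
Local Open Scope ring_scope.

(* The field is kept abstract because over R[i] conversion unfolds the
   arithmetic of complex numbers, and unification diverges. *)
Record real_part (R : realType) (C : numClosedFieldType) := RealPart {
  of_real :> {rmorphism R -> C};
  re : C -> R;
  reE : forall z, of_real (re z) = 'Re z;
  of_real_le : {mono of_real : x y / x <= y}
}.

(** * Adjoints and real scalars *)

Section Adjoint.
Variable C : numClosedFieldType.

Lemma adjmxM m n p (A : 'M[C]_(m, n)) (B : 'M[C]_(n, p)) :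
  (A *m B)^t* = B^t* *m A^t*.
Proof. by rewrite trmx_mul map_mxM. Qed.

Lemma adjmxD m n (A B : 'M[C]_(m, n)) : (A + B)^t* = A^t* + B^t*.
Proof. by rewrite linearD /= map_mxD. Qed.

Lemma adjmxN m n (A : 'M[C]_(m, n)) : (- A)^t* = - A^t*.
Proof. by rewrite linearN /= map_mxN. Qed.

Lemma adjmxB m n (A B : 'M[C]_(m, n)) : (A - B)^t* = A^t* - B^t*.
Proof. by rewrite adjmxD adjmxN. Qed.

Lemma adjmxZ m n (c : C) (A : 'M[C]_(m, n)) : (c *: A)^t* = Num.conj c *: A^t*.
Proof. by rewrite linearZ /= map_mxZ. Qed.

Lemma adjmx_sum m n (I : finType) (P : pred I) (F : I -> 'M[C]_(m, n)) :
  (\sum_(i | P i) F i)^t* = \sum_(i | P i) (F i)^t*.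
Proof. by rewrite linear_sum /= map_mx_sum. Qed.

Lemma mxtrace_adj n (A : 'M[C]_n) : \tr (A^t*) = Num.conj (\tr A).
Proof. by rewrite trace_map_mx mxtrace_tr. Qed.

Lemma diag_gramE m n (A : 'M[C]_(m, n)) i :
  (A^t* *m A) i i = \sum_j `|A j i| ^+ 2.
Proof. by rewrite mxE; apply: eq_bigr => j _; rewrite !mxE -normCKC. Qed.

Lemma diag_cogramE m n (A : 'M[C]_(m, n)) i :
  (A *m A^t*) i i = \sum_j `|A i j| ^+ 2.
Proof. by rewrite mxE; apply: eq_bigr => j _; rewrite !mxE -normCK. Qed.

Lemma hermsymmxE n (A : 'M[C]_n) : A \is hermsymmx <-> A^t* = A.
Proof.
split; first by move=> /is_hermitianmxP; rewrite expr0 scale1r => <-.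
by move=> h; apply/is_hermitianmxP; rewrite expr0 scale1r h.
Qed.

Lemma unitarymx_mulV n (P : 'M[C]_n) : P \is unitarymx -> P *m P^t* = 1%:M.
Proof. by move=> /unitarymxP. Qed.

Lemma unitarymx_Vmul n (P : 'M[C]_n) : P \is unitarymx -> P^t* *m P = 1%:M.
Proof. by move=> hP; rewrite -invmx_unitary // mulVmx // unitarymx_unit. Qed.

End Adjoint.

Section RealPart.
Variables (R : realType) (C : numClosedFieldType) (K : real_part R C).

Lemma of_real_real (x : R) : K x \is Num.real.
Proof. by rewrite realE -(rmorph0 K) !of_real_le -realE num_real. Qed.

Lemma conj_of_real (x : R) : Num.conj (K x) = K x.
Proof. exact/conj_Creal/of_real_real. Qed.

Lemma of_real_ge0 (x : R) : (0 <= K x) = (0 <= x).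
Proof. by rewrite -(rmorph0 K) of_real_le. Qed.

Lemma of_real_inj : injective K.
Proof. exact: fmorph_inj. Qed.

Lemma reK (z : C) : z \is Num.real -> K (re K z) = z.
Proof. by move=> hz; rewrite reE (Creal_ReP z _). Qed.

Lemma of_realK : cancel K (re K).
Proof. by move=> x; apply: of_real_inj; rewrite reK // of_real_real. Qed.

Lemma reD (x y : C) : re K (x + y) = re K x + re K y.
Proof. by apply: of_real_inj; rewrite rmorphD !reE raddfD. Qed.

Lemma re0 : re K 0 = 0.
Proof. by rewrite -(rmorph0 K) of_realK. Qed.

Lemma reN (x : C) : re K (- x) = - re K x.
Proof. by apply: of_real_inj; rewrite rmorphN !reE raddfN. Qed.

Lemma reB (x y : C) : re K (x - y) = re K x - re K y.
Proof. by rewrite reD reN. Qed.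

Lemma re_sum (I : Type) (s : seq I) (P : pred I) (F : I -> C) :
  re K (\sum_(i <- s | P i) F i) = \sum_(i <- s | P i) re K (F i).
Proof. by apply: (big_morph (re K) reD re0). Qed.

Lemma reZ (x : R) (z : C) : re K (K x * z) = x * re K z.
Proof.
by apply: of_real_inj; rewrite rmorphM !reE ReMl ?of_real_real.
Qed.

Lemma re_ge0 (z : C) : 0 <= z -> 0 <= re K z.
Proof. by move=> hz; rewrite -of_real_ge0 reK // ger0_real. Qed.

Lemma re_le_norm (z : C) : re K z <= re K `|z|.
Proof.
rewrite -(of_real_le K) [K (re K `|z|)]reK ?normr_real // reE.
by have [] := leif_Re_Creal z.
Qed.

Lemma adjmxZr m n (x : R) (A : 'M[C]_(m, n)) : (K x *: A)^t* = K x *: A^t*.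
Proof. by rewrite adjmxZ conj_of_real. Qed.

Lemma adjmx_real n (x : R) : ((K x)%:M : 'M[C]_n)^t* = (K x)%:M.
Proof. by rewrite tr_scalar_mx map_scalar_mx /= conj_of_real. Qed.

End RealPart.

(** * Functional calculus and positivity *)

Section SpectralCalculus.
Variables (R : realType) (C : numClosedFieldType) (K : real_part R C) (n : nat).
Implicit Types (A B X P Q : 'M[C]_n) (f g : 'I_n -> R) (phi psi : R -> R).

Definition rdiag f : 'M[C]_n := diag_mx (\row_i (K (f i))).

Fact hfun_key : unit. Proof. exact: tt. Qed.

(* Locked, so that rewriting with mulmxA does not unfold it into a product. *)
Definition hfun phi A : 'M[C]_n := locked_with hfun_key
  (let P := spectralmx A in
   invmx P *m diag_mx (map_mx (fun z => K (phi (re K z))) (spectral_diag A)) *m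
     P).

Definition ev A (i : 'I_n) : R := re K (spectral_diag A 0 i).

Lemma rdiag_mulmx m f (X : 'M[C]_(n, m)) i j : (rdiag f *m X) i j = (K (f i)) *
  X i j.
Proof. by rewrite mul_diag_mx !mxE. Qed.

Lemma mulmx_rdiag f X i j : (X *m rdiag f) i j = X i j * (K (f j)).
Proof. by rewrite mul_mx_diag !mxE. Qed.

Lemma rdiagM f g : rdiag f *m rdiag g = rdiag (fun i => f i * g i).
Proof.
apply/matrixP => i j; rewrite rdiag_mulmx !mxE.
by case: eqP => [->|_]; rewrite ?mulr0n ?mulr0 // !mulr1n rmorphM.
Qed.

Lemma rdiagD f g : rdiag f + rdiag g = rdiag (fun i => f i + g i).
Proof.
by apply/matrixP => i j; rewrite !mxE -mulrnDl rmorphD.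
Qed.

Lemma rdiag_cst (x : R) : rdiag (fun=> x) = (K x)%:M.
Proof. by apply/matrixP => i j; rewrite !mxE. Qed.

Lemma adjmx_rdiag f : (rdiag f)^t* = rdiag f.
Proof.
apply/matrixP => i j; rewrite !mxE eq_sym.
by case: eqP => [->|_]; rewrite ?mulr0n ?rmorph0 // !mulr1n /= conj_of_real.
Qed.

Lemma hfunE phi A :
  hfun phi A =
  (spectralmx A)^t* *m rdiag (fun i => phi (ev A i)) *m spectralmx A.
Proof.
rewrite /hfun locked_withE (invmx_unitary (spectral_unitarymx A)).
by congr mulmx; congr mulmx; congr diag_mx; apply/rowP => i; rewrite !mxE.
Qed.

Lemma spectralE A : A^t* = A ->
  A = (spectralmx A)^t* *m rdiag (ev A) *m spectralmx A.
Proof.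
move=> /hermsymmxE hA.
have /orthomx_spectralP e := hermitian_normalmx hA.
rewrite [LHS]e (invmx_unitary (spectral_unitarymx A)).
congr mulmx; congr mulmx; congr diag_mx; apply/rowP => i; rewrite !mxE reK //.
by have /mxOverP := hermitian_spectral_diag_real hA; apply.
Qed.

(** The entry (i, j) of the hypothesis forces f i = g j wherever X i j is nonzero, so [phi] may be
    applied on both sides. *)
Lemma rdiag_intertwine phi f g X :
  rdiag f *m X = X *m rdiag g ->
  rdiag (phi \o f) *m X = X *m rdiag (phi \o g).
Proof.
move=> /matrixP h; apply/matrixP => i j; have := h i j.
rewrite !rdiag_mulmx !mulmx_rdiag /=; have [->|nz] := eqVneq (X i j) 0.
  by rewrite !mulr0 !mul0r.
by rewrite mulrC => /(mulfI nz) /of_real_inj ->; rewrite mulrC.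
Qed.

(** Two uses: X = 1 shows that [hfun] does not depend on the diagonalisation, and P = Q gives
    commutation with everything that commutes with the matrix. *)
Lemma spectral_intertwine phi P Q f g X :
  P \is unitarymx -> Q \is unitarymx ->
  P^t* *m rdiag f *m P *m X = X *m (Q^t* *m rdiag g *m Q) ->
  P^t* *m rdiag (phi \o f) *m P *m X = X *m (Q^t* *m rdiag (phi \o g) *m Q).
Proof.
move=> hP hQ h.
have : rdiag f *m (P *m X *m Q^t*) = (P *m X *m Q^t*) *m rdiag g.
  transitivity (P *m (P^t* *m rdiag f *m P *m X) *m Q^t*).
    by rewrite !mulmxA (unitarymx_mulV hP) mul1mx.
  by rewrite h -!mulmxA (unitarymx_mulV hQ) mulmx1.
move=> /(rdiag_intertwine phi) e.
transitivity (P^t* *m (rdiag (phi \o f) *m (P *m X *m Q^t*)) *m Q).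
  by rewrite -!mulmxA (unitarymx_Vmul hQ) mulmx1.
by rewrite e !mulmxA (unitarymx_Vmul hP) mul1mx.
Qed.

Lemma hfun_unitary phi P f : P \is unitarymx ->
  hfun phi (P^t* *m rdiag f *m P) = P^t* *m rdiag (phi \o f) *m P.
Proof.
move=> hP; set A := _ *m P.
have hA : A^t* = A by rewrite /A !adjmxM trmxCK adjmx_rdiag mulmxA.
have := @spectral_intertwine phi (spectralmx A) P (ev A) f 1%:M
  (spectral_unitarymx _) hP.
by rewrite -spectralE // mulmx1 mul1mx => /(_ erefl);
  rewrite mulmx1 mul1mx hfunE.
Qed.

Lemma hfun_comm phi A X : A^t* = A ->
  A *m X = X *m A -> hfun phi A *m X = X *m hfun phi A.
Proof.
move=> hA; rewrite [in X in X -> _](spectralE hA) !hfunE.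
by apply: spectral_intertwine; exact: spectral_unitarymx.
Qed.

Lemma hfun_adj phi A : (hfun phi A)^t* = hfun phi A.
Proof. by rewrite hfunE !adjmxM trmxCK adjmx_rdiag mulmxA. Qed.

Lemma hfun_eq phi psi A : (forall i, phi (ev A i) = psi (ev A i)) ->
  hfun phi A = hfun psi A.
Proof.
move=> h; rewrite !hfunE; congr mulmx; congr mulmx; congr diag_mx.
by apply/rowP => i; rewrite !mxE h.
Qed.

Lemma hfun_id A : A^t* = A -> hfun id A = A.
Proof. by move=> hA; rewrite hfunE -spectralE. Qed.

Lemma hfunM phi psi A :
  hfun phi A *m hfun psi A = hfun (fun x => phi x * psi x) A.
Proof.
rewrite !hfunE -rdiagM !mulmxA; congr mulmx; congr mulmx.
by rewrite -!mulmxA (unitarymx_mulV (spectral_unitarymx A)) mulmx1.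
Qed.

Lemma hfunD phi psi A :
  hfun phi A + hfun psi A = hfun (fun x => phi x + psi x) A.
Proof. by rewrite !hfunE -rdiagD mulmxDr mulmxDl. Qed.

Lemma hfun_cst (x : R) A : hfun (fun=> x) A = (K x)%:M.
Proof.
rewrite hfunE rdiag_cst mul_mx_scalar -scalemxAl.
by rewrite (unitarymx_Vmul (spectral_unitarymx A)) scalemx1.
Qed.

Lemma hfun_comp phi psi A :
  hfun phi (hfun psi A) = hfun (phi \o psi) A.
Proof. by rewrite [hfun psi A]hfunE (hfun_unitary _ _ (spectral_unitarymx A))
  hfunE. Qed.

Lemma rdiag_trig_herm X : X^t* = X -> is_trig_mx X ->
  X = rdiag (fun i => re K (X i i)).
Proof.
move=> hX /is_trig_mxP tr; apply/matrixP => i j; rewrite !mxE.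
have hij (k l : 'I_n) : X k l = Num.conj (X l k) by rewrite -{1}hX !mxE.
case: eqP => [<-|/eqP nij].
  by rewrite mulr1n reK //; apply/CrealP; rewrite [RHS]hij.
rewrite mulr0n; have [lt|gt|eq] := ltngtP i j; last first.
- by rewrite (val_inj eq) eqxx in nij.
- by rewrite hij tr // rmorph0.
- by rewrite tr.
Qed.

Lemma unitary_diag_herm P X : P \is unitarymx -> X^t* = X ->
  is_trig_mx (P *m X *m P^t*) ->
  exists f, X = P^t* *m rdiag f *m P.
Proof.
move=> hP hX tr; set Y := P *m X *m P^t*.
have hY : Y^t* = Y by rewrite /Y !adjmxM trmxCK hX mulmxA.
exists (fun i => re K (Y i i)); rewrite -rdiag_trig_herm //.
rewrite /Y !mulmxA (unitarymx_Vmul hP) mul1mx -mulmxA (unitarymx_Vmul hP).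
by rewrite mulmx1.
Qed.

(** Simultaneous unitary triangularisation is enough, because a triangular Hermitian matrix is
    diagonal with real entries. *)
Lemma herm_codiag A B : A^t* = A -> B^t* = B -> A *m B = B *m A ->
  exists P f g, [/\ P \is unitarymx, A = P^t* *m rdiag f *m P
                  & B = P^t* *m rdiag g *m P].
Proof.
move=> hA hB /cotrigonalization2 [P hP].
move=> /andP [tA tB].
have [f ef] : exists f, A = P^t* *m rdiag f *m P.
  by apply: unitary_diag_herm => //; rewrite -(conjymx A hP).
have [g eg] : exists g, B = P^t* *m rdiag g *m P.
  by apply: unitary_diag_herm => //; rewrite -(conjymx B hP).
by exists P, f, g.
Qed.

Lemma expmxD A B : A^t* = A -> B^t* = B -> A *m B = B *m A ->
  hfun (@expR R) (A + B) = hfun (@expR R) A *m hfun (@expR R) B.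
Proof.
move=> hA hB /(herm_codiag hA hB) [P [f [g [hP -> ->]]]].
rewrite -mulmxDl -mulmxDr rdiagD !(hfun_unitary _ _ hP).
transitivity (P^t* *m (rdiag (@expR R \o f) *m rdiag (@expR R \o g)) *m P).
  rewrite rdiagM; congr mulmx; congr mulmx; congr diag_mx; apply/rowP => i.
  by rewrite !mxE /= expRD.
by rewrite -!mulmxA [P *m (_ *m _)]mulmxA (unitarymx_mulV hP) mul1mx.
Qed.

End SpectralCalculus.

Definition psdmx (C : numClosedFieldType) n (A : 'M[C]_n) : Prop :=
  forall v : 'cV[C]_n, 0 <= (v^t* *m A *m v) 0 0.

Section Positivity.
Variables (C : numClosedFieldType) (n : nat).
Implicit Types (A B X P Q : 'M[C]_n).

Lemma psdmxD A B : psdmx A -> psdmx B -> psdmx (A + B).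
Proof. by move=> hA hB v; rewrite mulmxDr mulmxDl mxE addr_ge0. Qed.

Lemma psdmxZ (c : C) A : 0 <= c -> psdmx A -> psdmx (c *: A).
Proof. by move=> hc hA v; rewrite -scalemxAr -scalemxAl mxE mulr_ge0. Qed.

Lemma psdmx0 : psdmx (0 : 'M[C]_n).
Proof. by move=> v; rewrite mulmx0 mul0mx mxE. Qed.

Lemma psdmx_sum (I : Type) (s : seq I) (P : pred I) (F : I -> 'M[C]_n) :
  (forall i, P i -> psdmx (F i)) -> psdmx (\sum_(i <- s | P i) F i).
Proof. by move=> h; apply: big_ind => //; [exact: psdmx0 | exact: psdmxD]. Qed.

Lemma psdmx_conj m (B : 'M[C]_(n, m)) A : psdmx A -> psdmx (B^t* *m A *m B).
Proof.
by move=> hA v; have := hA (B *m v); rewrite adjmxM !mulmxA.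
Qed.

Lemma cV_norm_ge0 (v : 'cV[C]_n) : 0 <= (v^t* *m v) 0 0.
Proof.
by rewrite mxE sumr_ge0 // => i _; rewrite !mxE mulrC mul_conjC_ge0.
Qed.

Lemma psdmx_scalar (c : C) : 0 <= c -> psdmx (c%:M : 'M[C]_n).
Proof.
move=> hc v; rewrite mul_mx_scalar -scalemxAl mxE mulr_ge0 //.
exact: cV_norm_ge0.
Qed.

Lemma psdmx_diag_ge0 A i : psdmx A -> 0 <= A i i.
Proof.
move=> /(_ (delta_mx i 0)); rewrite trmx_delta map_delta_mx.
by rewrite -rowE -colE !mxE.
Qed.

Lemma psdmx_tr_ge0 A : psdmx A -> 0 <= \tr A.
Proof. by move=> hA; apply: sumr_ge0 => i _; exact: psdmx_diag_ge0. Qed.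

Lemma psdmx_gram m (B : 'M[C]_(m, n)) : psdmx (B^t* *m B).
Proof.
move=> v; have := @cV_norm_ge0.
have -> : v^t* *m (B^t* *m B) *m v = (B *m v)^t* *m (B *m v).
  by rewrite adjmxM !mulmxA.
by move=> _; rewrite mxE sumr_ge0 // => i _; rewrite !mxE mulrC mul_conjC_ge0.
Qed.

(* The difference A - A^t* is normal with vanishing quadratic form, so all its
   eigenvalues are zero. *)
Lemma psdmx_herm A : psdmx A -> A^t* = A.
Proof.
move=> hA; pose B := A - A^t*.
have qB (v : 'cV[C]_n) : (v^t* *m B *m v) 0 0 = 0.
  rewrite /B mulmxBr mulmxBl mxE [X in _ + X]mxE.
  have -> : v^t* *m A^t* *m v = (v^t* *m A *m v)^t*.
    by rewrite !adjmxM trmxCK mulmxA.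
  have /ger0_real /CrealP := hA v.
  by move: (_ *m _) => w hw; rewrite [X in _ - X]mxE [X in _ - Num.conj X]mxE
    hw subrr.
have hBN : B \is normalmx.
  apply/normalmxP.
  have -> : B^t* = - B by rewrite /B adjmxB trmxCK opprB.
  by rewrite mulmxN mulNmx.
have /orthomx_spectralP eB := hBN.
rewrite (invmx_unitary (spectral_unitarymx B)) in eB.
suff B0 : B = 0 by apply/esym/eqP; rewrite -subr_eq0 -/B B0.
suff d0 : spectral_diag B = 0.
  by rewrite eB d0 linear0 mulmx0 mul0mx.
apply/rowP => i; rewrite [RHS]mxE.
have := qB ((spectralmx B)^t* *m delta_mx i 0).
rewrite [X in _ *m X *m _]eB adjmxM trmxCK !mulmxA.
rewrite !(mulmxtVK _ (spectral_unitarymx B)) trmx_delta map_delta_mx -rowE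
  -colE !mxE eqxx mulr1n.
by [].
Qed.

End Positivity.

Section SpectralPositivity.
Variables (R : realType) (C : numClosedFieldType) (K : real_part R C) (n : nat).
Implicit Types (A B X P Q : 'M[C]_n) (f g : 'I_n -> R) (phi psi : R -> R).
Local Notation rdiag := (rdiag K).
Local Notation hfun := (hfun K).
Local Notation ev := (ev K).

Lemma psdmx_rdiag f : (forall i, 0 <= f i) -> psdmx (rdiag f).
Proof.
move=> hf v; rewrite -mulmxA mxE sumr_ge0 // => i _.
rewrite rdiag_mulmx !mxE mulrCA mulr_ge0 ?of_real_ge0 //.
by rewrite mulrC mul_conjC_ge0.
Qed.

Lemma psdmx_ev_ge0 A i : psdmx A -> 0 <= ev A i.
Proof.
move=> hA; have h := psdmx_herm hA.
rewrite -(of_real_ge0 K).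
have := psdmx_diag_ge0 i (psdmx_conj ((spectralmx A)^t*) hA).
rewrite [X in _ *m X *m _](spectralE K h) trmxCK !mulmxA.
rewrite (unitarymx_mulV (spectral_unitarymx A)) mul1mx -mulmxA.
rewrite (unitarymx_mulV (spectral_unitarymx A)) mulmx1 !mxE eqxx mulr1n.
by [].
Qed.

Lemma psdmx_hfun phi A : (forall i, 0 <= phi (ev A i)) -> psdmx (hfun phi A).
Proof.
move=> h; rewrite hfunE; apply: psdmx_conj; exact: psdmx_rdiag.
Qed.

Lemma psdmx_of_ev A : A^t* = A -> (forall i, 0 <= ev A i) -> psdmx A.
Proof. by move=> hA h; rewrite -(hfun_id K hA); apply: psdmx_hfun. Qed.

Definition sqrtmx A := hfun (@Num.sqrt R) A.

Lemma sqrtmxK A : psdmx A -> sqrtmx A *m sqrtmx A = A.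
Proof.
move=> hA; rewrite /sqrtmx hfunM -[RHS](hfun_id K (psdmx_herm hA)).
by apply: hfun_eq => i; rewrite -expr2 sqr_sqrtr // psdmx_ev_ge0.
Qed.

(** The square root of A also commutes with B, so A B is B conjugated by that root. *)
Lemma psdmxM A B : psdmx A -> psdmx B -> A *m B = B *m A -> psdmx (A *m B).
Proof.
move=> hA hB c; rewrite -[A in A *m B](sqrtmxK hA) -mulmxA.
rewrite (hfun_comm K _ (psdmx_herm hA) c) mulmxA.
rewrite -{1}[sqrtmx A](hfun_adj K); exact: psdmx_conj.
Qed.

Lemma psdmx_trM_ge0 A B : psdmx A -> psdmx B -> 0 <= \tr (A *m B).
Proof.
move=> hA hB; rewrite -(sqrtmxK hA) -mulmxA mxtrace_mulC -{1}[sqrtmx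
  A](hfun_adj K).
exact/psdmx_tr_ge0/psdmx_conj.
Qed.

End SpectralPositivity.

(** * Relative entropy and Pinsker's inequality *)

Section RelativeEntropy.
Variables (R : realType) (C : numClosedFieldType) (K : real_part R C) (n : nat).
Implicit Types (A B X P Q rho sigma : 'M[C]_n) (phi psi : R -> R).
Local Notation rdiag := (rdiag K).
Local Notation hfun := (hfun K).
Local Notation ev := (ev K).

Definition relent rho sigma : R :=
  re K (\tr (rho *m hfun (@ln R) rho - rho *m hfun (@ln R) sigma)).

Definition overlap rho sigma : 'M[C]_n := spectralmx rho *m (spectralmx
  sigma)^t*.

Definition weight rho sigma i j : R := re K (`|overlap rho sigma i j| ^+ 2).

Lemma weight_ge0 rho sigma i j : 0 <= weight rho sigma i j.
Proof. by rewrite re_ge0 // exprn_ge0. Qed.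

Lemma tr_hfunM2 phi psi rho sigma X :
  \tr (hfun phi rho *m hfun psi sigma *m X) =
  \sum_i \sum_j K (phi (ev rho i)) * K (psi (ev sigma j)) *
    (overlap rho sigma i j *
     (spectralmx sigma *m X *m (spectralmx rho)^t*) j i).
Proof.
rewrite !hfunE; set P := spectralmx rho; set Q := spectralmx sigma.
set f := rdiag _; set g := rdiag _.
have -> : \tr (P^t* *m f *m P *m (Q^t* *m g *m Q) *m X) =
          \tr (f *m (P *m Q^t* *m (g *m (Q *m X *m P^t*)))).
  by rewrite -!mulmxA mxtrace_mulC -!mulmxA.
rewrite /mxtrace; apply: eq_bigr => i _; rewrite rdiag_mulmx mxE mulr_sumr.
by apply: eq_bigr => j _; rewrite rdiag_mulmx /overlap -/P -/Q; ring.
Qed.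

Lemma tr_hfunM phi psi rho sigma :
  re K (\tr (hfun phi rho *m hfun psi sigma)) =
  \sum_i \sum_j weight rho sigma i j * (phi (ev rho i) * psi (ev sigma j)).
Proof.
rewrite -[_ *m _]mulmx1 tr_hfunM2 re_sum; apply: eq_bigr => i _.
rewrite re_sum; apply: eq_bigr => j _.
rewrite mulmx1 -rmorphM reZ mulrC; congr (_ * _); congr re.
have -> : spectralmx sigma *m (spectralmx rho)^t* = (overlap rho sigma)^t*.
  by rewrite /overlap adjmxM trmxCK.
by rewrite !mxE normCK.
Qed.

Lemma tr_hfun phi rho X :
  \tr (hfun phi rho *m X) =
  \sum_i K (phi (ev rho i)) * (spectralmx rho *m X *m (spectralmx rho)^t*) i i.
Proof.
rewrite hfunE -!mulmxA mxtrace_mulC -!mulmxA /mxtrace.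
by apply: eq_bigr => i _; rewrite rdiag_mulmx.
Qed.

Lemma relentE rho sigma : rho^t* = rho ->
  relent rho sigma = \sum_i \sum_j weight rho sigma i j *
    (ev rho i * ln (ev rho i) - ev rho i * ln (ev sigma j)).
Proof.
move=> hrho; rewrite /relent linearB /= reB.
rewrite -{1 3}(hfun_id K hrho) hfunM -[hfun _ _ in X in X - _]mulmx1.
rewrite -[1%:M](_ : hfun (fun=> 1) sigma = _); last by rewrite hfun_cst rmorph1.
rewrite !tr_hfunM -sumrB; apply: eq_bigr => i _; rewrite -sumrB.
by apply: eq_bigr => j _; rewrite -mulrBr mulr1.
Qed.

Lemma tr_weightl rho sigma : rho^t* = rho ->
  re K (\tr rho) = \sum_i \sum_j weight rho sigma i j * ev rho i.
Proof.
move=> h; rewrite -{1}[rho](hfun_id K h) -[hfun _ _]mulmx1.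
rewrite -[1%:M](_ : hfun (fun=> 1) sigma = _); last by rewrite hfun_cst rmorph1.
rewrite tr_hfunM; apply: eq_bigr => i _; apply: eq_bigr => j _.
by rewrite mulr1.
Qed.

Lemma tr_weightr rho sigma : sigma^t* = sigma ->
  re K (\tr sigma) = \sum_i \sum_j weight rho sigma i j * ev sigma j.
Proof.
move=> h; rewrite -{1}[sigma](hfun_id K h) -[hfun _ _]mul1mx.
rewrite -[1%:M](_ : hfun (fun=> 1) rho = _); last by rewrite hfun_cst rmorph1.
rewrite tr_hfunM; apply: eq_bigr => i _; apply: eq_bigr => j _.
by rewrite mul1r.
Qed.

(** Let a and b be the square roots of p and q. Multiplying ln (b / a) <= b / a - 1 by 2 a^2 gives p
    ln p - p ln q >= 2 a^2 - 2 a b, which is the left side. *)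
Lemma xlnx_hellinger (p q : R) : 0 <= p -> 0 < q ->
  p - q + (Num.sqrt p - Num.sqrt q) ^+ 2 <= p * ln p - p * ln q.
Proof.
move=> hp hq; have [->|pn0] := eqVneq p 0.
  by rewrite sqrtr0 !mul0r !sub0r sqrrN sqr_sqrtr ?(ltW hq) // addNr oppr0.
have p0 : 0 < p by rewrite lt_neqAle eq_sym pn0.
set a := Num.sqrt p; set b := Num.sqrt q.
have a0 : 0 < a by rewrite sqrtr_gt0.
have b0 : 0 < b by rewrite sqrtr_gt0.
have ep : p = a * a by rewrite -expr2 sqr_sqrtr.
have eq : q = b * b by rewrite -expr2 sqr_sqrtr // ltW.
have ab0 : 0 < b / a by rewrite divr_gt0.
have h := expR_ge1Dx (ln (b / a)); rewrite lnK ?posrE // ln_div ?posrE // in h.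
have h2 : a * a * (1 + (ln b - ln a)) <= a * b.
  apply: le_trans (ler_wpM2l (ltW (mulr_gt0 a0 a0)) h) _.
  by rewrite mulrACA mulfV ?gt_eqF // mulr1 ?mulrA // mulfK ?gt_eqF.
rewrite ep eq !lnM ?posrE //; move: (ln a) (ln b) h2 => x y h2.
by nra.
Qed.

(* Klein's inequality with the Hellinger remainder; the joint weights of the two
   eigenbases (Nussbaum and Szkola) reduce it to the scalar case. *)
Lemma relent_hellinger rho sigma : psdmx rho -> psdmx sigma ->
  (forall j, 0 < ev sigma j) -> \tr rho = 1 -> \tr sigma = 1 ->
  \sum_i \sum_j weight rho sigma i j *
    (Num.sqrt (ev rho i) - Num.sqrt (ev sigma j)) ^+ 2 <= relent rho sigma.
Proof.
move=> hr hs ps tr ts; have hr' := psdmx_herm hr; have hs' := psdmx_herm hs.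
have e0 : \sum_i \sum_j weight rho sigma i j * (ev rho i - ev sigma j) = 0.
  transitivity (re K (\tr rho) - re K (\tr sigma)); last by rewrite tr ts subrr.
  rewrite (tr_weightl sigma hr') (tr_weightr rho hs') -sumrB.
  apply: eq_bigr => i _; rewrite -sumrB; apply: eq_bigr => j _.
  by rewrite mulrBr.
rewrite relentE // -[leLHS]add0r -{1}e0 -big_split /=.
apply: ler_sum => i _; rewrite -big_split /=; apply: ler_sum => j _.
rewrite -mulrDr; apply: ler_wpM2l; first exact: weight_ge0.
by apply: xlnx_hellinger => //; apply: psdmx_ev_ge0.
Qed.

Lemma relent_ge0 rho sigma : psdmx rho -> psdmx sigma ->
  (forall j, 0 < ev sigma j) -> \tr rho = 1 -> \tr sigma = 1 ->
  0 <= relent rho sigma.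
Proof.
move=> hr hs ps tr ts; apply: le_trans (relent_hellinger hr hs ps tr ts).
apply: sumr_ge0 => i _; apply: sumr_ge0 => j _.
by rewrite mulr_ge0 ?weight_ge0 // sqr_ge0.
Qed.

(** The norm bound in order form, which every positive unital map preserves; this is how it passes
    through [ptrace] and [condexp]. *)
Definition bounded_by (c : R) X : Prop :=
  psdmx ((K c)%:M - X) /\ psdmx ((K c)%:M + X).

Lemma bounded_by_herm c X : bounded_by c X -> X^t* = X.
Proof.
move=> [_ /psdmx_herm]; rewrite adjmxD adjmx_real => /addrI.
by [].
Qed.

Lemma bounded_by_sqr c X : bounded_by c X -> psdmx ((K (c ^+ 2))%:M - X *m X).
Proof.
move=> [h1 h2].
have e1 : (K (c ^+ 2))%:M - X *m X = ((K c)%:M - X) *m ((K c)%:M + X).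
  rewrite mulmxDr !mulmxBl -scalar_mxM -rmorphM -expr2.
  by rewrite -[(K c)%:M *m X]scalar_mxC addrA subrK.
have e2 : (K (c ^+ 2))%:M - X *m X = ((K c)%:M + X) *m ((K c)%:M - X).
  rewrite mulmxBr !mulmxDl -scalar_mxM -rmorphM -expr2.
  by rewrite scalar_mxC opprD addrA addrK.
by rewrite e1; apply: (psdmxM K) => //; rewrite -e1.
Qed.

(* Pinsker's inequality, up to the constant, in linearised form: optimising
   over t gives tr ((rho - sigma) X) <= 2 c sqrt (D (rho || sigma)). *)
Lemma pinsker rho sigma X (c t : R) : psdmx rho -> psdmx sigma ->
  (forall j, 0 < ev sigma j) -> \tr rho = 1 -> \tr sigma = 1 ->
  0 < c -> bounded_by c X -> 0 < t ->
  re K (\tr ((rho - sigma) *m X)) <= c * (t * relent rho sigma + t^-1).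
Proof.
move=> hr hs ps tr ts c0 hX t0.
have hr' := psdmx_herm hr; have hs' := psdmx_herm hs.
have hX' := bounded_by_herm hX.
pose V := spectralmx sigma *m X *m (spectralmx rho)^t*.
pose u i j := re K `|overlap rho sigma i j|.
pose v i j := re K `|V j i|.
have u0 i j : 0 <= u i j by rewrite re_ge0.
have v0 i j : 0 <= v i j by rewrite re_ge0.
have eu i j : u i j ^+ 2 = weight rho sigma i j.
  by apply: (of_real_inj (K := K)); rewrite /weight rmorphXn !reK ?rpredX //
    normr_real.
have ev2 i j : re K (`|V j i| ^+ 2) = v i j ^+ 2.
  by apply: (of_real_inj (K := K)); rewrite rmorphXn !reK ?rpredX // normr_real.
pose a i j := Num.sqrt (ev rho i) - Num.sqrt (ev sigma j).
pose b i j := Num.sqrt (ev rho i) + Num.sqrt (ev sigma j).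
(* The factorisation p - q = (sqrt p - sqrt q) (sqrt p + sqrt q) leaves the first factor to the
   Hellinger remainder ([T2]) and the second to the traces of rho X^2 and sigma X^2 ([T3]). *)
have T1 : re K (\tr ((rho - sigma) *m X)) <=
    \sum_i \sum_j `|a i j| * u i j * (b i j * v i j).
  have -> : \tr ((rho - sigma) *m X) =
     \sum_i \sum_j K (ev rho i - ev sigma j) * (overlap rho sigma i j * V j i).
    rewrite mulmxBl linearB /=.
    have -> : rho *m X = hfun id rho *m hfun (fun=> 1) sigma *m X.
      by rewrite hfun_id // hfun_cst rmorph1 mulmx1.
    have -> : sigma *m X = hfun (fun=> 1) rho *m hfun id sigma *m X.
      by rewrite hfun_id // hfun_cst rmorph1 mul1mx.
    rewrite !tr_hfunM2 -sumrB; apply: eq_bigr => i _; rewrite -sumrB.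
    by apply: eq_bigr => j _; rewrite rmorph1 mulr1 mul1r -mulrBl rmorphB.
  rewrite re_sum; apply: ler_sum => i _; rewrite re_sum; apply: ler_sum => j _.
  apply: le_trans (re_le_norm K _) _; rewrite !normrM.
  have -> : ev rho i - ev sigma j = a i j * b i j.
    rewrite /a /b -[in LHS](sqr_sqrtr (psdmx_ev_ge0 K i hr)).
    by rewrite -[X in _ - X = _](sqr_sqrtr (ltW (ps j))) subr_sqr.
  have -> : `|K (a i j * b i j)| = K (`|a i j| * b i j).
    have b0 : 0 <= b i j by rewrite addr_ge0 ?sqrtr_ge0.
    have [h|h] := lerP 0 (a i j).
      by rewrite (ger0_norm h) ger0_norm // of_real_ge0 mulr_ge0.
    rewrite (ltr0_norm h) ler0_norm; first by rewrite -rmorphN mulNr.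
    by rewrite -(rmorph0 K) of_real_le mulr_le0_ge0 // ltW.
  rewrite reZ; have -> : re K (`|overlap rho sigma i j| * `|V j i|) = u i j * v
    i j.
    by rewrite -{1}(reK K (normr_real (overlap rho sigma i j))) reZ.
  by rewrite mulrACA.
have T2 : \sum_i \sum_j weight rho sigma i j * a i j ^+ 2 <= relent rho sigma.
  exact: relent_hellinger.
have ev0 i : 0 <= ev rho i by apply: psdmx_ev_ge0.
have tX rh : psdmx rh -> \tr rh = 1 -> re K (\tr (rh *m (X *m X))) <= c ^+ 2.
  move=> hrh trh; have := re_ge0 K (psdmx_trM_ge0 K hrh (bounded_by_sqr hX)).
  rewrite mulmxBr linearB /= reB mul_mx_scalar linearZ /= trh mulr1 of_realK.
  by rewrite subr_ge0.
have e1 : re K (\tr (rho *m (X *m X))) = \sum_i \sum_j ev rho i * v i j ^+ 2.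
  rewrite -{1}(hfun_id K hr') tr_hfun re_sum; apply: eq_bigr => i _.
  rewrite reZ -mulr_sumr; congr (_ * _).
  have -> : spectralmx rho *m (X *m X) *m (spectralmx rho)^t* = V^t* *m V.
    rewrite /V !adjmxM trmxCK hX' !mulmxA.
    by rewrite -[_ *m _ *m spectralmx sigma]mulmxA
       (unitarymx_Vmul (spectral_unitarymx sigma)) mulmx1.
  by rewrite diag_gramE re_sum; apply: eq_bigr => j _; rewrite ev2.
have e2 : re K (\tr (sigma *m (X *m X))) = \sum_i \sum_j ev sigma j * v i j ^+
  2.
  rewrite exchange_big /=.
  rewrite -{1}(hfun_id K hs') tr_hfun re_sum; apply: eq_bigr => i _.
  rewrite reZ -mulr_sumr; congr (_ * _).
  have -> : spectralmx sigma *m (X *m X) *m (spectralmx sigma)^t* = V *m V^t*.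
    rewrite /V !adjmxM trmxCK hX' !mulmxA.
    by rewrite -[_ *m _ *m spectralmx rho]mulmxA
       (unitarymx_Vmul (spectral_unitarymx rho)) mulmx1.
  by rewrite diag_cogramE re_sum; apply: eq_bigr => j _; rewrite ev2.
have T3 : \sum_i \sum_j (b i j * v i j) ^+ 2 <= 4 * c ^+ 2.
  apply: (@le_trans _ _ (\sum_i \sum_j
     (2 * (ev rho i * v i j ^+ 2) + 2 * (ev sigma j * v i j ^+ 2)))).
    apply: ler_sum => i _; apply: ler_sum => j _.
    rewrite exprMn -!mulrA -mulrDr [2 * _]mulrC.
    rewrite -[in leRHS](sqr_sqrtr (ev0 i)) -[in leRHS](sqr_sqrtr (ltW (ps j))).
    rewrite /b; move: (Num.sqrt _) (Num.sqrt _) (v i j) => x y z.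
    by have := sqr_ge0 ((x - y) * z); nra.
  apply: (@le_trans _ _ (2 * re K (\tr (rho *m (X *m X))) +
                         2 * re K (\tr (sigma *m (X *m X))))).
    rewrite e1 e2 !mulr_sumr -big_split /=; apply: ler_sum => i _.
    by rewrite !mulr_sumr -big_split.
  by have := tX _ hr tr; have := tX _ hs ts; lra.
apply: le_trans T1 _.
(* In x y <= s x^2 / 2 + y^2 / (2 s) this choice turns the bounds of [T2] and [T3] into c t D and c
   / t. *)
pose s := 2 * c * t.
have s0 : 0 < s by rewrite !mulr_gt0.
apply: (@le_trans _ _ (\sum_i \sum_j (2^-1 * s * (weight rho sigma i j * a i j
  ^+ 2)
     + 2^-1 * s^-1 * (b i j * v i j) ^+ 2))).
  apply: ler_sum => i _; apply: ler_sum => j _.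
  rewrite -eu -exprMn -[(u i j * a i j) ^+ 2]real_normK ?num_real // normrM.
  rewrite (ger0_norm (u0 i j)) [u i j * _]mulrC.
  move: (_ * u i j) (_ * v i j) => x y.
  have -> : 2^-1 * s * x ^+ 2 + 2^-1 * s^-1 * y ^+ 2 =
     x * y + 2^-1 * s^-1 * (s * x - y) ^+ 2.
    by field; rewrite gt_eqF.
  by rewrite lerDl mulr_ge0 ?sqr_ge0 // mulr_ge0 ?invr_ge0 ?ltW.
under eq_bigr do rewrite big_split /= -!mulr_sumr.
rewrite big_split /= -!mulr_sumr.
have -> : c * (t * relent rho sigma + t^-1) =
   2^-1 * s * relent rho sigma + 2^-1 * s^-1 * (4 * c ^+ 2).
  by rewrite /s; field; rewrite !gt_eqF.
apply: lerD; apply: ler_wpM2l => //.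
  by rewrite mulr_ge0 ?invr_ge0 // ltW.
by rewrite mulr_ge0 ?invr_ge0 // ltW.
Qed.

End RelativeEntropy.

(** * Positive definite matrices, exponential and logarithm *)

Section PositiveDefinite.
Variables (R : realType) (C : numClosedFieldType) (K : real_part R C) (n : nat).
Implicit Types (A B X P Q H : 'M[C]_n) (phi psi : R -> R).
Local Notation hfun := (hfun K).
Local Notation ev := (ev K).

Definition pdmx A : Prop := A^t* = A /\ forall i, 0 < ev A i.

Definition expmx H := hfun (@expR R) H.
Definition lnmx A := hfun (@ln R) A.
Definition hinvmx A := hfun (fun x => x^-1) A.

Lemma pdmx_psd A : pdmx A -> psdmx A.
Proof. by move=> [h p]; apply: (psdmx_of_ev (K := K)) => // i; apply: ltW. Qed.

Lemma evE A i : A^t* = A ->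
  K (ev A i) = (spectralmx A *m A *m (spectralmx A)^t*) i i.
Proof.
move=> hA; rewrite [X in _ = (_ *m X *m _) i i](spectralE K hA) !mulmxA.
rewrite (unitarymx_mulV (spectral_unitarymx A)) mul1mx.
by rewrite (mulmxtVK _ (spectral_unitarymx A)) !mxE eqxx mulr1n.
Qed.

(** With [pdmx_lb] this describes definiteness by a scalar lower bound, a form that survives sums
    and positive unital maps. *)
Lemma pdmx_of_lb A (e : R) : 0 < e -> psdmx (A - (K e)%:M) -> pdmx A.
Proof.
move=> e0 h; have hA : A^t* = A.
  by have := psdmx_herm h; rewrite adjmxB adjmx_real => /addIr.
split => // i; apply: lt_le_trans e0 _; rewrite -(of_real_le K) evE //.
have := psdmx_diag_ge0 i (psdmx_conj ((spectralmx A)^t*) h).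
rewrite trmxCK mulmxBr mulmxBl mul_mx_scalar -scalemxAl.
rewrite (unitarymx_mulV (spectral_unitarymx A)) scalemx1.
by rewrite mxE [X in _ + X]mxE [X in _ - X]mxE eqxx mulr1n subr_ge0.
Qed.

Lemma pos_lb (f : 'I_n -> R) : (forall i, 0 < f i) ->
  exists2 e : R, 0 < e & forall i, e <= f i.
Proof.
move=> hf; exists (\big[Num.min/1]_i f i).
  by apply: (big_ind (fun x => 0 < x)) => // x y x0 y0; rewrite lt_min x0 y0.
by move=> i; rewrite (bigD1 i) //= ge_min lexx.
Qed.

Lemma pdmx_hfun phi A : (forall i, 0 < phi (ev A i)) -> pdmx (hfun phi A).
Proof.
move=> /pos_lb [e e0 he]; apply: (pdmx_of_lb e0).
rewrite -(hfun_cst K e A) -[X in _ - X](hfun_id K (hfun_adj _ _ _)).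
rewrite hfun_comp -scaleN1r.
have -> : -1 *: hfun (id \o (fun=> e)) A = hfun (fun=> - e) A.
  by rewrite !hfun_cst scaleN1r rmorphN /= raddfN.
by rewrite hfunD; apply: psdmx_hfun => i; rewrite subr_ge0.
Qed.

Lemma pdmx_lb A : pdmx A -> exists2 e : R, 0 < e & psdmx (A - (K e)%:M).
Proof.
move=> [hA /pos_lb [e e0 he]]; exists e => //.
have -> : A - (K e)%:M = hfun (fun x => x - e) A.
  by rewrite -hfunD hfun_id // hfun_cst rmorphN raddfN.
by apply: psdmx_hfun => i; rewrite subr_ge0.
Qed.

Lemma expmx_pd H : pdmx (expmx H).
Proof. by apply: pdmx_hfun => i; apply: expR_gt0. Qed.

Lemma expmxK H : H^t* = H -> lnmx (expmx H) = H.
Proof.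
move=> hH; rewrite /lnmx /expmx hfun_comp -[RHS](hfun_id K hH).
by apply: hfun_eq => i /=; rewrite expRK.
Qed.

Lemma lnmxK A : pdmx A -> expmx (lnmx A) = A.
Proof.
move=> [hA pA]; rewrite /lnmx /expmx hfun_comp -[RHS](hfun_id K hA).
by apply: hfun_eq => i /=; rewrite lnK ?posrE.
Qed.

Lemma pdmx_mulV A : pdmx A -> A *m hinvmx A = 1%:M.
Proof.
move=> [hA pA]; rewrite /hinvmx -{1}(hfun_id K hA) hfunM.
rewrite -(rmorph1 K) -(hfun_cst K 1 A).
by apply: hfun_eq => i; rewrite mulfV // gt_eqF.
Qed.

Lemma pdmx_Vmul A : pdmx A -> hinvmx A *m A = 1%:M.
Proof. by move=> /pdmx_mulV /mulmx1C. Qed.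

Lemma pdmx_inv A : pdmx A -> pdmx (hinvmx A).
Proof. by move=> [hA pA]; apply: pdmx_hfun => i; rewrite invr_gt0. Qed.

Lemma lnmx_comm A B : A^t* = A -> B^t* = B -> A *m B = B *m A ->
  lnmx A *m lnmx B = lnmx B *m lnmx A.
Proof.
move=> hA hB c; apply: (hfun_comm K _ hA); apply/esym.
by apply: (hfun_comm K _ hB).
Qed.

Lemma pdmxM A B : pdmx A -> pdmx B -> A *m B = B *m A -> pdmx (A *m B).
Proof.
move=> pA pB c; rewrite -(lnmxK pA) -(lnmxK pB) -expmxD ?hfun_adj //.
  exact: expmx_pd.
exact: lnmx_comm pA.1 pB.1 c.
Qed.

Lemma lnmxM A B : pdmx A -> pdmx B -> A *m B = B *m A ->
  lnmx (A *m B) = lnmx A + lnmx B.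
Proof.
move=> pA pB c; rewrite -{1}(lnmxK pA) -{1}(lnmxK pB) -expmxD ?hfun_adj //.
  by rewrite expmxK // adjmxD !hfun_adj.
exact: lnmx_comm pA.1 pB.1 c.
Qed.

Lemma pdmxZ (x : R) A : 0 < x -> pdmx A -> pdmx (K x *: A).
Proof.
move=> x0 /pdmx_lb [e e0 h]; apply: (@pdmx_of_lb _ (x * e)).
  by rewrite mulr_gt0.
have := psdmxZ _ h; move=> /(_ (K x)); rewrite of_real_ge0 ltW //.
by rewrite scalerBr scale_scalar_mx -rmorphM; apply.
Qed.

Lemma pdmxD A B : psdmx A -> pdmx B -> pdmx (A + B).
Proof.
move=> hA /pdmx_lb [e e0 h]; apply: (pdmx_of_lb e0).
by rewrite -addrA; apply: psdmxD.
Qed.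

End PositiveDefinite.

(** * Conditional expectations on commutants *)

Section StarCommutant.
Variables (R : realType) (C : numClosedFieldType) (K : real_part R C) (n : nat).
Implicit Types (A B X Y W P Q H : 'M[C]_n) (G : set 'M[C]_n).

Definition commutant G : set 'M[C]_n :=
  [set X | forall g, G g -> g *m X = X *m g].

Definition star_closed G : Prop := forall g, G g -> G (g^t*).

Lemma commutantD G X Y : commutant G X -> commutant G Y -> commutant G (X + Y).
Proof. by move=> hX hY g hg; rewrite mulmxDr mulmxDl hX // hY. Qed.

Lemma commutantZ G (c : C) X : commutant G X -> commutant G (c *: X).
Proof. by move=> hX g hg; rewrite -scalemxAr -scalemxAl hX. Qed.

Lemma commutantN G X : commutant G X -> commutant G (- X).
Proof. by move=> hX; rewrite -scaleN1r; apply: commutantZ. Qed.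

Lemma commutantB G X Y : commutant G X -> commutant G Y -> commutant G (X - Y).
Proof. by move=> hX /commutantN; apply: commutantD. Qed.

Lemma commutantM G X Y : commutant G X -> commutant G Y -> commutant G (X *m Y).
Proof. by move=> hX hY g hg; rewrite mulmxA hX // -mulmxA hY // mulmxA. Qed.

Lemma commutant_scalar G (c : C) : commutant G c%:M.
Proof. by move=> g hg; rewrite scalar_mxC. Qed.

Lemma commutant1 G : commutant G 1%:M.
Proof. exact: commutant_scalar. Qed.

Lemma commutant0 G : commutant G 0.
Proof. by move=> g hg; rewrite mulmx0 mul0mx. Qed.

Lemma commutant_sum G (I : Type) (s : seq I) (p : pred I) (F : I -> 'M[C]_n) :
  (forall i, p i -> commutant G (F i)) -> commutant G (\sum_(i <- s | p i) F i).
Proof.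
by move=> h; apply: big_ind => //; [exact: commutant0 | exact: commutantD].
Qed.

Lemma commutant_adj G X : star_closed G -> commutant G X -> commutant G (X^t*).
Proof.
move=> sG hX g /sG /hX /(congr1 (fun Z : 'M[C]_n => Z^t*)).
by rewrite !adjmxM trmxCK => ->.
Qed.

Lemma commutant_hfun G (phi : R -> R) X : X^t* = X -> commutant G X ->
  commutant G (hfun K phi X).
Proof. by move=> hX cX g hg; apply/esym/(hfun_comm K _ hX)/esym/cX. Qed.

Lemma commutantS G G' : G `<=` G' -> commutant G' `<=` commutant G.
Proof. by move=> s X hX g /s; apply: hX. Qed.

(** A matrix of maximal rank among those whose row space lies in S works: a vector of S outside the
    row space would raise the rank. The commutant thus becomes a row space, to which [proj_ortho]
    applies. *)
Lemma subspace_rowspan m (S : 'rV[C]_m -> Prop) :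
  S 0 -> (forall a u v, S u -> S v -> S (a *: u + v)) ->
  exists U : 'M[C]_m, forall v, S v <-> (v <= U)%MS.
Proof.
move=> S0 SD.
pose p r := `[< exists U : 'M[C]_m,
   \rank U = r /\ forall v : 'rV_m, (v <= U)%MS -> S v >].
have p0 : exists r, p r.
  exists 0; apply/asboolP; exists 0; split; first by rewrite mxrank0.
  by move=> v; rewrite submx0 => /eqP ->.
have pm r : p r -> (r <= m)%N.
  by move=> /asboolP [U [<- _]]; exact: rank_leq_row.
case: (ex_maxnP p0 pm) => r /asboolP [U [rU SU]] rmax.
exists U => v; split; last exact: SU.
move=> Sv; apply/negPn/negP => nvU.
have Sa (w : 'rV_m) : (w <= U + v)%MS -> S w.
  move=> /sub_addsmxP [[u c] /= ->]; rewrite addrC.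
  rewrite [c]mx11_scalar mul_scalar_mx; apply: SD => //; apply: SU.
  exact: submxMl.
have : (\rank (U + v)%MS <= r)%N.
  by apply: rmax; apply/asboolP; exists (U + v)%MS.
rewrite -rU leqNgt => /negP; apply; apply: rank_ltmx.
by rewrite ltmxE addsmxSl; apply: contra nvU; apply: submx_trans;
  exact: addsmxSr.
Qed.

Lemma mxvec_dot X Y : (mxvec X *m (mxvec Y)^t*) 0 0 = \tr (X *m Y^t*).
Proof.
rewrite mxE /mxtrace (reindex _ (curry_mxvec_bij _ _)) /=.
under [RHS]eq_bigr do rewrite mxE.
rewrite pair_bigA; apply: eq_bigr => -[i j] _ /=.
by rewrite mxvecE [X in _ * X = _]mxE [X in _ * Num.conj X = _]mxE mxvecE !mxE.
Qed.

Lemma commutant_proj_exists G X : star_closed G -> exists Y, commutant G Y /\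
  forall W, commutant G W -> \tr (Y *m W) = \tr (X *m W).
Proof.
move=> sG.
have [||U hU] := @subspace_rowspan _ (fun v : 'rV_(n * n) => commutant G
  (vec_mx v)).
- by rewrite linear0; exact: commutant0.
- by move=> a u v hu hv; rewrite linearP; apply/commutantD => //;
  apply: commutantZ.
exists (vec_mx (mxvec X *m proj_ortho U)); split.
  by apply/hU; exact: proj_ortho_sub.
move=> W hW; apply/esym/eqP; rewrite -subr_eq0 -linearB /= -mulmxBl.
(* The trace against W is the inner product with the adjoint of W, which lies in the commutant
   because G is star closed. *)
rewrite -[W]trmxCK -mxvec_dot linearB /= vec_mxK.
have /submxP [a ea] : (mxvec (W^t*) <= U)%MS.
  by apply/hU; rewrite mxvecK; exact: commutant_adj.
have /orthomx1P h := proj_ortho_compl_sub U (mxvec X).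
by rewrite ea adjmxM mulmxA h mul0mx mxE.
Qed.

(** Defined by its trace pairings, the form in which it is used. The default 0 of [xget] is never
    reached for star-closed G, by [commutant_proj_exists]. *)
Definition commutant_proj G X : 'M[C]_n :=
  xget 0 [set Y | commutant G Y /\
    forall W, commutant G W -> \tr (Y *m W) = \tr (X *m W)].

End StarCommutant.

Section CommutantProjection.
Variables (R : realType) (C : numClosedFieldType) (K : real_part R C) (n : nat).
Variable G : set 'M[C]_n.
Hypothesis starG : star_closed G.
Implicit Types (A B X Y Z W P Q H : 'M[C]_n).
Local Notation N := (commutant G).
Local Notation proj := (commutant_proj G).

Lemma projP X : N (proj X) /\ forall W, N W -> \tr (proj X *m W) = \tr (X *m W).
Proof.
have [Y hY] := commutant_proj_exists X starG.
by rewrite /commutant_proj; case: xgetP => [Z -> //|/(_ Y)].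
Qed.

Lemma proj_in X : N (proj X).
Proof. by have [] := projP X. Qed.

Lemma proj_tr X W : N W -> \tr (proj X *m W) = \tr (X *m W).
Proof. by have [_] := projP X; apply. Qed.

Lemma proj_trr X W : N W -> \tr (W *m proj X) = \tr (W *m X).
Proof. by move=> hW; rewrite mxtrace_mulC proj_tr // mxtrace_mulC. Qed.

Lemma gram_eq0 X : \tr (X *m X^t*) = 0 -> X = 0.
Proof.
rewrite /mxtrace => h; apply/matrixP => i j; rewrite [RHS]mxE.
have h0 k : 0 <= (X *m X^t*) k k by rewrite diag_cogramE sumr_ge0 // => ? _;
  rewrite exprn_ge0.
move/eqP: h; rewrite psumr_eq0 // => /allP /(_ i (mem_index_enum _)) /=.
rewrite diag_cogramE psumr_eq0 => [|? _]; last by rewrite exprn_ge0.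
by move=> /allP /(_ j (mem_index_enum _)) /=;
  rewrite expf_eq0 normr_eq0 => /eqP.
Qed.

(** The difference of the two candidates lies in the commutant, so it may be tested against its own
    adjoint. *)
Lemma proj_uniq X Y : N Y -> (forall W, N W -> \tr (Y *m W) = \tr (X *m W)) ->
  proj X = Y.
Proof.
move=> hY h; apply/eqP; rewrite -subr_eq0; apply/eqP/gram_eq0.
rewrite mulmxBl linearB /= proj_tr.
  rewrite h ?subrr //; apply: commutant_adj => //; apply: commutantB => //.
  exact: proj_in.
apply: commutant_adj => //; apply: commutantB => //; exact: proj_in.
Qed.

Lemma proj_id X : N X -> proj X = X.
Proof. by move=> hX; apply: proj_uniq. Qed.

Lemma projD X Y : proj (X + Y) = proj X + proj Y.
Proof.
apply: proj_uniq => [|W hW]; first by apply: commutantD; exact: proj_in.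
by rewrite !mulmxDl !linearD /= !proj_tr.
Qed.

Lemma projZ (c : C) X : proj (c *: X) = c *: proj X.
Proof.
apply: proj_uniq => [|W hW]; first by apply: commutantZ; exact: proj_in.
by rewrite -!scalemxAl !linearZ /= !proj_tr.
Qed.

Lemma projN X : proj (- X) = - proj X.
Proof. by rewrite -scaleN1r projZ scaleN1r. Qed.

Lemma projB X Y : proj (X - Y) = proj X - proj Y.
Proof. by rewrite projD projN. Qed.

Lemma proj_adj X : proj (X^t*) = (proj X)^t*.
Proof.
apply: proj_uniq => [|W hW]; first by apply: commutant_adj => //;
  exact: proj_in.
rewrite -[W]trmxCK -!adjmxM !mxtrace_adj proj_trr //.
exact: commutant_adj.
Qed.

Lemma proj_mull X Y : N Y -> proj (Y *m X) = Y *m proj X.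
Proof.
move=> hY; apply: proj_uniq => [|W hW].
  by apply: commutantM => //; exact: proj_in.
rewrite -!mulmxA mxtrace_mulC -mulmxA proj_tr; last exact: commutantM.
by rewrite [RHS]mxtrace_mulC mulmxA.
Qed.

Lemma proj_mulr X Y : N Y -> proj (X *m Y) = proj X *m Y.
Proof.
move=> hY; apply: proj_uniq => [|W hW].
  by apply: commutantM => //; exact: proj_in.
by rewrite -!mulmxA proj_tr //; exact: commutantM.
Qed.

Lemma proj_comm M X : (forall W, N W -> M *m W = W *m M) ->
  proj (M *m X) = proj (X *m M).
Proof.
move=> cM; apply: proj_uniq => [|W hW]; first exact: proj_in.
by rewrite proj_tr // -mulmxA cM // mulmxA mxtrace_mulC mulmxA.
Qed.

(* Testing against the spectral projection of proj Z on its negative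
   eigenvalues, which belongs to the commutant. *)
Lemma proj_psd_test Z : Z^t* = Z ->
  (forall W, N W -> psdmx W -> 0 <= \tr (Z *m W)) -> psdmx (proj Z).
Proof.
move=> hZ h; set Y := proj Z.
have hY : Y^t* = Y by rewrite /Y -proj_adj hZ.
pose phi (x : R) : R := ((x < 0)%R)%:R.
have phi0 x : 0 <= phi x by rewrite ler0n.
apply: (psdmx_of_ev (K := K)) => // i; rewrite leNgt; apply/negP => neg.
have NW : N (hfun K phi Y) by apply: commutant_hfun => //; exact: proj_in.
have := h _ NW (psdmx_hfun (fun i => phi0 (ev K Y i))).
rewrite -proj_tr // -/Y -{1}(hfun_id K hY) hfunM.
rewrite -[hfun _ _ _]mulmx1 tr_hfun.
under eq_bigr do rewrite mulmx1 (unitarymx_mulV (spectral_unitarymx Y)) mxE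
  eqxx mulr1n mulr1.
rewrite -rmorph_sum of_real_ge0 leNgt => /negP; apply.
rewrite (bigD1 i) //= /phi neg mulr1 -[ltRHS]addr0; apply: ltr_leD => //.
apply: sumr_le0 => j _; case: ltP => [/ltW|]; first by rewrite mulr1.
by rewrite mulr0.
Qed.

Lemma proj_psd X : psdmx X -> psdmx (proj X).
Proof.
move=> hX; apply: proj_psd_test; first exact: psdmx_herm.
by move=> W _ hW; apply: (psdmx_trM_ge0 K).
Qed.

(** M X need not be Hermitian, but by [proj_comm] it has the same projection as X M and may be
    symmetrised. Against a positive W its trace is that of X times the positive matrix W M. *)
Lemma proj_psdM M X : psdmx M -> (forall W, N W -> M *m W = W *m M) ->
  psdmx X -> psdmx (proj (M *m X)).
Proof.
move=> hM cM hX; have hM' := psdmx_herm hM; have hX' := psdmx_herm hX.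
have e : proj (M *m X) = proj (2^-1 *: (M *m X + X *m M)).
  rewrite projZ projD -(proj_comm X cM) -mulr2n -scaler_nat scalerA mulVf
    ?scale1r //.
  by rewrite pnatr_eq0.
rewrite e; apply: proj_psd_test.
  rewrite adjmxZ adjmxD !adjmxM hM' hX' addrC; congr (_ *: _).
  by rewrite fmorphV rmorph_nat.
move=> W NW hW.
rewrite -scalemxAl mulmxDl linearZ /= linearD /=.
have -> : \tr (M *m X *m W) = \tr (X *m (W *m M)) by rewrite -mulmxA
  mxtrace_mulC mulmxA.
rewrite -mulmxA cM //; apply: mulr_ge0; first by rewrite invr_ge0 ler0n.
have t0 : 0 <= \tr (X *m (W *m M)).
  by apply: (psdmx_trM_ge0 K) => //; apply: (psdmxM K) => //; rewrite cM.
by rewrite addr_ge0.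
Qed.

Lemma proj_pd X : pdmx K X -> pdmx K (proj X).
Proof.
move=> /pdmx_lb [e e0 h]; apply: (pdmx_of_lb e0).
rewrite -(proj_id (commutant_scalar (G := G) (K e))) -projB.
exact: proj_psd.
Qed.

End CommutantProjection.

(** * Weighted conditional expectations and their duals *)

Section ConditionalExpectation.
Variables (R : realType) (C : numClosedFieldType) (K : real_part R C) (n : nat).
Variable G : set 'M[C]_n.
Hypothesis starG : star_closed G.
Variable M : 'M[C]_n.
Hypothesis pdM : pdmx K M.
Hypothesis cM : forall W, commutant G W -> M *m W = W *m M.
Implicit Types (A B X Y Z W P Q H rho : 'M[C]_n).
Local Notation N := (commutant G).
Local Notation proj := (commutant_proj G).
Local Notation pM := (proj M).
Local Notation ipM := (hinvmx K (proj M)).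

Fact condexp_key : unit. Proof. exact: tt. Qed.

Definition condexp X : 'M[C]_n :=
  locked_with condexp_key (proj (M *m X) *m ipM).

Definition condexp_dual rho : 'M[C]_n :=
  locked_with condexp_key (M *m (proj rho *m ipM)).

Lemma condexpE X : condexp X = proj (M *m X) *m ipM.
Proof. by rewrite /condexp locked_withE. Qed.

Lemma condexp_dual_def rho : condexp_dual rho = M *m (proj rho *m ipM).
Proof. by rewrite /condexp_dual locked_withE. Qed.

Lemma projM_pd : pdmx K pM.
Proof. exact: proj_pd. Qed.

(** M commutes with the commutant, so [proj] takes the same value on M W and W M. Thus [proj M] is
    central in the commutant. *)
Lemma projM_comm W : N W -> pM *m W = W *m pM.
Proof. by move=> hW; rewrite -proj_mulr // cM // proj_mull. Qed.

Lemma iprojM_in : N ipM.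
Proof.
by apply: commutant_hfun; [case: projM_pd | exact: proj_in].
Qed.

Lemma iprojM_comm W : N W -> ipM *m W = W *m ipM.
Proof.
move=> hW; apply: (hfun_comm K); first by case: projM_pd.
exact: projM_comm.
Qed.

Lemma condexp_in X : N (condexp X).
Proof. by rewrite condexpE; apply: commutantM;
  [exact: proj_in | exact: iprojM_in]. Qed.

Lemma condexp_tr X W : N W -> \tr (M *m condexp X *m W) = \tr (M *m X *m W).
Proof.
move=> hW; rewrite -mulmxA -(proj_tr starG); last first.
  by apply: commutantM => //; exact: condexp_in.
rewrite condexpE mulmxA (projM_comm (commutantM (proj_in starG _) iprojM_in)).
by rewrite -[_ *m ipM *m pM]mulmxA (pdmx_Vmul projM_pd) mulmx1 proj_tr.
Qed.

(** The weighted trace pairings determine the expectation. The tower property and the comparison of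
    different generating sets both reduce to this. *)
Lemma condexp_uniq X Y : N Y ->
  (forall W, N W -> \tr (M *m Y *m W) = \tr (M *m X *m W)) -> condexp X = Y.
Proof.
move=> hY h; rewrite condexpE (proj_uniq starG (Y := pM *m Y)).
- by rewrite (projM_comm hY) -mulmxA (pdmx_mulV projM_pd) mulmx1.
- by apply: commutantM => //; exact: proj_in.
- by move=> W hW; rewrite -mulmxA proj_tr ?mulmxA ?h //; exact: commutantM.
Qed.

Lemma condexp_id X : N X -> condexp X = X.
Proof. by move=> hX; apply: condexp_uniq. Qed.

Lemma condexpD X Y : condexp (X + Y) = condexp X + condexp Y.
Proof. by rewrite !condexpE mulmxDr projD // mulmxDl. Qed.

Lemma condexpB X Y : condexp (X - Y) = condexp X - condexp Y.
Proof. by rewrite !condexpE mulmxBr projB // mulmxBl. Qed.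

Lemma condexp_comm u X : N u -> u *m X = X *m u ->
  u *m condexp X = condexp X *m u.
Proof.
move=> hu c; rewrite condexpE -mulmxA (iprojM_comm hu) !mulmxA.
by congr (_ *m _); rewrite -proj_mull // -proj_mulr // mulmxA -cM // -!mulmxA c.
Qed.

Lemma condexp_psd X : psdmx X -> psdmx (condexp X).
Proof.
move=> hX; rewrite condexpE; apply: (psdmxM K).
- by apply: (proj_psdM K) => //; exact: pdmx_psd pdM.
- exact: pdmx_psd (pdmx_inv projM_pd).
- by rewrite iprojM_comm //; exact: proj_in.
Qed.

Lemma condexp_scalar (c : C) : condexp c%:M = c%:M.
Proof. by apply: condexp_id; exact: commutant_scalar. Qed.

Lemma condexp_bounded (c : R) X : bounded_by K c X -> bounded_by K c (condexp
  X).
Proof.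
move=> [h1 h2]; split.
  have -> : (K c)%:M - condexp X = condexp ((K c)%:M - X).
    by rewrite condexpB condexp_scalar.
  exact: condexp_psd.
have -> : (K c)%:M + condexp X = condexp ((K c)%:M + X).
  by rewrite condexpD condexp_scalar.
exact: condexp_psd.
Qed.

Lemma condexp_dualE rho X :
  \tr (condexp_dual rho *m X) = \tr (rho *m condexp X).
Proof.
have c := iprojM_comm (proj_in starG rho).
rewrite condexp_dual_def cM; last first.
  by apply: commutantM; [exact: proj_in | exact: iprojM_in].
rewrite -mulmxA mxtrace_mulC.
have -> : \tr (rho *m condexp X) = \tr (proj (M *m X) *m (ipM *m proj rho)).
  by rewrite -(proj_tr starG rho (condexp_in X)) condexpE mxtrace_mulC -mulmxA.
rewrite c (proj_tr starG) //.
by apply: commutantM; [exact: proj_in | exact: iprojM_in].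
Qed.

Lemma condexp_dual_pd rho : pdmx K rho -> pdmx K (condexp_dual rho).
Proof.
move=> h; have c := iprojM_comm (proj_in starG rho).
rewrite condexp_dual_def; apply: pdmxM => //.
  by apply: pdmxM; [exact: proj_pd | exact/pdmx_inv/projM_pd | ].
by apply: cM; apply: commutantM; [exact: proj_in | exact: iprojM_in].
Qed.

Lemma condexp_dual_tr rho : \tr (condexp_dual rho) = \tr rho.
Proof.
by rewrite -[condexp_dual rho]mulmx1 condexp_dualE condexp_id ?mulmx1 //;
  exact: commutant1.
Qed.

(** States of the form M W are invariant; by [gibbsmx_factor] the Gibbs state has this form for
    every block. *)
Lemma condexp_dual_stationary W X : N W ->
  \tr (M *m W *m condexp X) = \tr (M *m W *m X).
Proof.
move=> hW; rewrite (cM hW) -mulmxA mxtrace_mulC condexp_tr //.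
by rewrite mxtrace_mulC mulmxA.
Qed.

(* ln (E* rho) - ln sigma lies in the commutant, since E* rho = M Q and
   sigma = M W with Q and W in it. *)
Lemma relent_chain rho W : pdmx K rho -> pdmx K W -> N W ->
  relent K rho (M *m W) =
  relent K rho (condexp_dual rho) + relent K (condexp_dual rho) (M *m W).
Proof.
move=> pr pW hW.
have c := iprojM_comm (proj_in starG rho).
set Q := proj rho *m ipM.
have hQ : N Q by apply: commutantM; [exact: proj_in | exact: iprojM_in].
have pQ : pdmx K Q.
  by apply: pdmxM; [exact: proj_pd | exact/pdmx_inv/projM_pd | ].
have eQ : lnmx K (condexp_dual rho) = lnmx K M + lnmx K Q.
  by rewrite condexp_dual_def; apply: lnmxM => //; exact: cM.
have eW : lnmx K (M *m W) = lnmx K M + lnmx K W by apply: lnmxM => //;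
  exact: cM.
have key : \tr (condexp_dual rho *m (lnmx K Q - lnmx K W)) =
           \tr (rho *m (lnmx K Q - lnmx K W)).
  rewrite condexp_dualE condexp_id //.
  by apply: commutantB; apply: commutant_hfun => //; [case: pQ | case: pW].
have relE r s : relent K r s = re K (\tr (r *m (lnmx K r - lnmx K s))).
  by rewrite /relent mulmxBr.
rewrite !relE -reD; congr re.
move: key; rewrite eQ eW.
have -> : lnmx K M + lnmx K Q - (lnmx K M + lnmx K W) = lnmx K Q - lnmx K W.
  by rewrite opprD addrACA subrr add0r.
move=> ->; rewrite -linearD /= -mulmxDr; congr (\tr (_ *m _)).
by rewrite opprD addrA [in RHS]opprD !addrA subrK.
Qed.

End ConditionalExpectation.

(** Pairing with M2 = M1 R1 is pairing with M1 once R1, an element of the larger algebra, is moved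
    into the test matrix, and the first expectation preserves such pairings. *)
Lemma condexp_tower (R : realType) (C : numClosedFieldType) (K : real_part R C)
    n (G1 G2 : set 'M[C]_n) (M1 M2 R1 X : 'M[C]_n) :
  star_closed G1 -> star_closed G2 -> pdmx K M1 -> pdmx K M2 ->
  (forall W, commutant G1 W -> M1 *m W = W *m M1) ->
  (forall W, commutant G2 W -> M2 *m W = W *m M2) ->
  (forall W, commutant G2 W -> commutant G1 W) ->
  commutant G1 R1 -> M2 = M1 *m R1 ->
  condexp K G2 M2 (condexp K G1 M1 X) = condexp K G2 M2 X.
Proof.
move=> s1 s2 p1 p2 c1 c2 s12 hR e; apply/esym/condexp_uniq => //.
  exact: condexp_in.
move=> W hW; rewrite condexp_tr // e (c1 _ hR).
rewrite -!mulmxA mxtrace_mulC [RHS]mxtrace_mulC -!mulmxA.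
rewrite !(mulmxA M1) condexp_tr //; apply: commutantM => //; exact: s12.
Qed.

(** * Order bounds and perturbation of the weight *)

Section Perturbation.
Variables (R : realType) (C : numClosedFieldType) (K : real_part R C) (n : nat).
Implicit Types (X Y S W : 'M[C]_n) (G : set 'M[C]_n).

Lemma bounded_by_ev (b : R) S i : bounded_by K b S -> - b <= ev K S i <= b.
Proof.
move=> hS; have hS' := bounded_by_herm hS; case: hS => h1 h2.
have diagE : forall s : C, (spectralmx S *m (s%:M : 'M_n) *m (spectralmx S)^t*)
  i i = s.
  move=> s; rewrite mul_mx_scalar -scalemxAl.
  by rewrite (unitarymx_mulV (spectral_unitarymx S)) scalemx1 mxE eqxx mulr1n.
have := psdmx_diag_ge0 i (psdmx_conj ((spectralmx S)^t*) h1).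
have := psdmx_diag_ge0 i (psdmx_conj ((spectralmx S)^t*) h2).
rewrite trmxCK mulmxBr mulmxBl mulmxDr mulmxDl.
have diagD (A B : 'M[C]_n) : (A + B) i i = A i i + B i i by rewrite mxE.
have diagB (A B : 'M[C]_n) : (A - B) i i = A i i - B i i by rewrite !mxE.
rewrite diagD diagB diagE -(evE K i hS') -rmorphD -rmorphB !of_real_ge0 => h3
  h4.
by apply/andP; split; lra.
Qed.

Lemma bounded_by_of_ev (c : R) S : S^t* = S -> (forall i, `|ev K S i| <= c) ->
  bounded_by K c S.
Proof.
move=> hS hc; have hc' i : - c <= ev K S i <= c by rewrite -ler_norml.
have eN : - S = hfun K (fun x => - x) S.
  transitivity (hfun K (fun=> -1) S *m hfun K id S).
    by rewrite hfun_cst hfun_id // rmorphN rmorph1 mul_scalar_mx scaleN1r.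
  by rewrite hfunM; apply: hfun_eq => i; rewrite mulN1r.
split.
  have -> : (K c)%:M - S = hfun K (fun x => c - x) S.
    by rewrite eN -(hfun_cst K c S) hfunD.
  by apply: psdmx_hfun => i; rewrite subr_ge0; have /andP [] := hc' i.
have -> : (K c)%:M + S = hfun K (fun x => c + x) S.
  by rewrite -{1}(hfun_id K hS) -(hfun_cst K c S) hfunD.
by apply: psdmx_hfun => i; rewrite -lerBlDl sub0r; have /andP [] := hc' i.
Qed.

Lemma bounded_by_exists S : S^t* = S -> exists2 c : R, 0 <= c & bounded_by K c
  S.
Proof.
move=> hS; exists (\sum_i `|ev K S i|); first exact: sumr_ge0.
by apply: bounded_by_of_ev => // i; rewrite (bigD1 i) //= lerDl sumr_ge0.
Qed.

Lemma bounded_byN (c : R) S : bounded_by K c S -> bounded_by K c (- S).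
Proof. by move=> [h1 h2]; split; rewrite ?opprK. Qed.

Lemma bounded_byZ (x c : R) S : 0 <= x -> bounded_by K c S ->
  bounded_by K (x * c) (K x *: S).
Proof.
move=> x0 [h1 h2]; have kx : 0 <= K x by rewrite of_real_ge0.
rewrite /bounded_by rmorphM -scale_scalar_mx.
by split; [rewrite -scalerBr | rewrite -scalerDr]; apply: psdmxZ.
Qed.

Lemma expmx_lb (b : R) S : bounded_by K b S ->
  psdmx (expmx K S - (K (expR (- b)))%:M).
Proof.
move=> hS; have -> : expmx K S - (K (expR (- b)))%:M =
    hfun K (fun x => expR x - expR (- b)) S.
  by rewrite -hfunD hfun_cst rmorphN raddfN.
apply: psdmx_hfun => i; rewrite subr_ge0 ler_expR.
by have /andP [] := bounded_by_ev i hS.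
Qed.

Lemma expmx_ub (b : R) S : bounded_by K b S ->
  psdmx ((K (expR b))%:M - expmx K S).
Proof.
move=> hS; have -> : (K (expR b))%:M - expmx K S =
    hfun K (fun x => expR b - expR x) S.
  rewrite -(hfunD _ (fun=> expR b)) hfun_cst; congr (_ + _).
  have -> : hfun K (fun x => - expR x) S = hfun K (fun x => (fun=> -1) x * expR
    x) S.
    by apply: hfun_eq => i; rewrite mulN1r.
  by rewrite -hfunM hfun_cst rmorphN rmorph1 mul_scalar_mx scaleN1r.
apply: psdmx_hfun => i; rewrite subr_ge0 ler_expR.
by have /andP [] := bounded_by_ev i hS.
Qed.

(** One factor exp (- b) comes from the numerator P (M w X), the other from the inverse of P (M w).
    The commutation hypotheses make all products of positive matrices involved positive. *)
Lemma condexp_perturb G (M w X : 'M[C]_n) (b : R) : star_closed G ->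
  pdmx K M -> pdmx K w -> M *m w = w *m M ->
  (forall W, commutant G W -> M *m W = W *m M) ->
  (forall W, commutant G W -> w *m W = W *m w) ->
  psdmx (w - (K (expR (- b)))%:M) -> psdmx ((K (expR b))%:M - w) ->
  psdmx X -> M *m X = X *m M -> w *m X = X *m w ->
  psdmx (condexp K G (M *m w) X - K (expR (- b) ^+ 2) *: condexp K G M X).
Proof.
move=> sG pM pw cMw cM cw lb ub pX cMX cwX.
have cMw' W : commutant G W -> M *m w *m W = W *m (M *m w).
  by move=> hW; rewrite -mulmxA cw // mulmxA cM // mulmxA.
have pMw : pdmx K (M *m w) by exact: pdmxM.
pose N := commutant G; pose P := commutant_proj G.
pose A := hinvmx K (P (M *m w)); pose B := hinvmx K (P M).
have NA : N A by exact: iprojM_in.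
have NB : N B by exact: iprojM_in.
have cA W : N W -> A *m W = W *m A by exact: iprojM_comm.
have cB W : N W -> B *m W = W *m B by exact: iprojM_comm.
have pA : psdmx A by apply: (pdmx_psd (pdmx_inv (projM_pd _ _))).
have pB : psdmx B by apply: (pdmx_psd (pdmx_inv (projM_pd _ _))).
set c := expR (- b); have c0 : 0 <= c by exact: expR_ge0.
have ec : c * expR b = 1 by rewrite -expRD addNr expR0.
have NU Y : N (P Y) by exact: proj_in.
have h1 : psdmx (P (M *m w *m X) - K c *: P (M *m X)).
  rewrite -projZ // -projB //.
  have -> : M *m w *m X - K c *: (M *m X) = M *m ((w - (K c)%:M) *m X).
    by rewrite mulmxBl mulmxBr mul_scalar_mx -scalemxAr mulmxA.
  apply: (proj_psdM K) => //; first exact: pdmx_psd pM.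
  by apply: (psdmxM K) => //; rewrite mulmxBl mulmxBr cwX scalar_mxC.
have h2 : psdmx (K (expR b) *: P M - P (M *m w)).
  rewrite -projZ // -projB //.
  have -> : K (expR b) *: M - M *m w = M *m ((K (expR b))%:M - w).
    by rewrite mulmxBr mul_mx_scalar.
  apply: (proj_psd K) => //; apply: (psdmxM K) => //; first exact: pdmx_psd pM.
  by rewrite mulmxBl mulmxBr cMw scalar_mxC.
have h3 : psdmx (A - K c *: B).
  have -> : A - K c *: B =
      K c *: (A *m (K (expR b) *: P M - P (M *m w)) *m B).
    rewrite mulmxBr mulmxBl -scalemxAr -scalemxAl -[A *m P M *m B]mulmxA.
    rewrite (pdmx_mulV (projM_pd _ _)) // mulmx1.
    rewrite (pdmx_Vmul (projM_pd _ _)) // mul1mx scalerBr scalerA -rmorphM ec.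
    by rewrite rmorph1 scale1r.
  apply: psdmxZ; first by rewrite of_real_ge0.
  have NM : N (K (expR b) *: P M - P (M *m w)).
    exact: (commutantB (commutantZ _ (NU _)) (NU _)).
  apply: (psdmxM K) => //; last by rewrite cB //; apply: commutantM.
  by apply: (psdmxM K) => //; rewrite cA.
have pU0 : psdmx (P (M *m X)) by apply: (proj_psdM K) => //;
  exact: (pdmx_psd pM).
have -> : condexp K G (M *m w) X - K (c ^+ 2) *: condexp K G M X =
   (P (M *m w *m X) - K c *: P (M *m X)) *m A +
   K c *: (P (M *m X) *m (A - K c *: B)).
  rewrite !condexpE -/A -/B mulmxBl mulmxBr scalerBr -!scalemxAl -scalemxAr.
  by rewrite scalerA -rmorphM -expr2 addrA subrK.
apply: psdmxD.
  apply: (psdmxM K) => //; rewrite cA //.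
  exact: (commutantB (NU _) (commutantZ _ (NU _))).
apply: psdmxZ; first by rewrite of_real_ge0.
apply: (psdmxM K) => //; rewrite mulmxBl mulmxBr -cA // -scalemxAl -scalemxAr.
by rewrite cB.
Qed.

End Perturbation.

(** * Commuting lattice systems *)

Section LatticeSystem.
Variables (R : realType) (C : numClosedFieldType) (K : real_part R C).
Variables (n d : nat) (T F : finType).
(** [e x a b] stands for the matrix unit (a, b) at site x. Locality is expressed by commutation with
    these units, so no tensor product structure enters this section. *)
Variable e : T -> 'I_d -> 'I_d -> 'M[C]_n.
Hypothesis e_adj : forall x a b, (e x a b)^t* = e x b a.
Hypothesis e_mul : forall x a b b' c,
  e x a b *m e x b' c = if b == b' then e x a c else 0.
Hypothesis e_sum : forall x, \sum_a e x a a = 1%:M.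
Hypothesis e_comm : forall x y a b a' b', x != y ->
  e x a b *m e y a' b' = e y a' b' *m e x a b.
Implicit Types (S : pred T) (X Y Z W rho : 'M[C]_n).

Definition trivial_on S X : Prop :=
  forall x a b, S x -> e x a b *m X = X *m e x a b.

Lemma trivial_on_sub S S' X : {subset S <= S'} ->
  trivial_on S' X -> trivial_on S X.
Proof. by move=> s h x a b hx; apply: h; apply: s. Qed.

Lemma trivial_onD S X Y : trivial_on S X -> trivial_on S Y -> trivial_on S (X +
  Y).
Proof. by move=> hX hY x a b hx; rewrite mulmxDr mulmxDl hX ?hY. Qed.

Lemma trivial_onB S X Y : trivial_on S X -> trivial_on S Y -> trivial_on S (X -
  Y).
Proof. by move=> hX hY x a b hx; rewrite mulmxBr mulmxBl hX ?hY. Qed.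

Lemma trivial_on_scalar S (c : C) : trivial_on S c%:M.
Proof. by move=> x a b _; rewrite scalar_mxC. Qed.

(** The normalised partial trace over site x, tensored back with the identity there. *)
Definition ptrace (x : T) X : 'M[C]_n :=
  K (d%:R^-1) *: \sum_a \sum_b (e x a b *m X *m e x b a).

Lemma ptraceB x X Y : ptrace x (X - Y) = ptrace x X - ptrace x Y.
Proof.
rewrite /ptrace -scalerBr -sumrB; congr (_ *: _); apply: eq_bigr => a _.
by rewrite -sumrB; apply: eq_bigr => b _; rewrite mulmxBr mulmxBl.
Qed.

Lemma ptraceD x X Y : ptrace x (X + Y) = ptrace x X + ptrace x Y.
Proof.
rewrite /ptrace -scalerDr -big_split; congr (_ *: _); apply: eq_bigr => a _.
by rewrite -big_split; apply: eq_bigr => b _; rewrite mulmxDr mulmxDl.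
Qed.

Lemma ptrace_herm x X : X^t* = X -> (ptrace x X)^t* = ptrace x X.
Proof.
move=> hX; rewrite /ptrace adjmxZr adjmx_sum exchange_big /=; congr (_ *: _).
rewrite exchange_big /=; apply: eq_bigr => a _; rewrite adjmx_sum.
by apply: eq_bigr => b _; rewrite !adjmxM !e_adj hX mulmxA.
Qed.

Lemma ptrace_trivial x X : trivial_on (pred1 x) (ptrace x X).
Proof.
move=> y a b /eqP ->; rewrite /ptrace -scalemxAr -scalemxAl; congr (_ *: _).
transitivity (\sum_c (e x a c *m X *m e x c b)).
  rewrite mulmx_sumr (bigD1 b) //= mulmx_sumr [X in _ + X]big1 => [|a' na'].
    by rewrite addr0; apply: eq_bigr => c _; rewrite !mulmxA e_mul eqxx.
  rewrite mulmx_sumr big1 // => c _.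
  by rewrite !mulmxA e_mul eq_sym (negPf na') !mul0mx.
rewrite mulmx_suml [RHS](bigD1 a) //= mulmx_suml [X in _ + X]big1 => [|a' na'].
  by rewrite addr0; apply: eq_bigr => c _; rewrite -!mulmxA e_mul eqxx.
rewrite mulmx_suml big1 // => c _.
by rewrite -!mulmxA e_mul (negPf na') !mulmx0.
Qed.

Lemma ptrace_trivial_other x S X : ~~ S x -> trivial_on S X ->
  trivial_on S (ptrace x X).
Proof.
move=> nSx hX y a b hy; have nxy : y != x by apply: contraNneq nSx => <-.
rewrite /ptrace -scalemxAr -scalemxAl; congr (_ *: _).
rewrite mulmx_sumr mulmx_suml; apply: eq_bigr => a' _.
rewrite mulmx_sumr mulmx_suml; apply: eq_bigr => b' _.
rewrite !mulmxA (e_comm _ _ _ _ nxy) -[_ *m e y a b *m X]mulmxA hX //.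
by rewrite -!mulmxA (e_comm _ _ _ _ nxy).
Qed.

Lemma ptrace_id x X : (0 < d)%N -> trivial_on (pred1 x) X -> ptrace x X = X.
Proof.
move=> d0 hX; rewrite /ptrace.
have -> : \sum_a \sum_b (e x a b *m X *m e x b a) = d%:R *: X.
  rewrite -[in RHS](mulmx1 X) -(e_sum x) mulmx_sumr scaler_sumr.
  apply: eq_bigr => a _; rewrite (eq_bigr (fun=> X *m e x a a)) => [|b _].
    by rewrite sumr_const card_ord scaler_nat.
  by rewrite hX /= ?eqxx // -mulmxA e_mul eqxx.
rewrite scalerA fmorphV rmorph_nat mulVf ?scale1r // pnatr_eq0.
by rewrite -lt0n.
Qed.

Lemma ptrace_psd x X : psdmx X -> psdmx (ptrace x X).
Proof.
move=> hX; apply: psdmxZ; first by rewrite of_real_ge0 invr_ge0 ler0n.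
apply: psdmx_sum => a _; apply: psdmx_sum => b _.
by rewrite -[e x a b]e_adj; apply: psdmx_conj.
Qed.

Lemma ptrace_bounded x (c : R) X : (0 < d)%N -> bounded_by K c X ->
  bounded_by K c (ptrace x X).
Proof.
move=> d0 [h1 h2]; have e1 := ptrace_id d0 (@trivial_on_scalar (pred1 x) (K c)).
by split; rewrite -e1 -?ptraceB -?ptraceD; apply: ptrace_psd.
Qed.

(** Sites are removed one at a time by [ptrace]. Each costs 2: [ptrace x] fixes the approximant that
    is trivial at x, so it moves X by at most 1 + 1, and it does not increase the error made
    before. *)
Lemma trivial_on_approx X : (0 < d)%N -> X^t* = X ->
  (forall x, exists Y, trivial_on (pred1 x) Y /\ bounded_by K 1 (X - Y)) ->
  forall s : seq T, exists Y, [/\ Y^t* = Y, trivial_on (mem s) Y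
    & bounded_by K ((size s).*2)%:R (X - Y)].
Proof.
move=> d0 hX h; elim=> [|x s [Y [hY tY bY]]].
  exists X; split => //; rewrite subrr /bounded_by /= !rmorph0 raddf0.
  by rewrite addr0; split; exact: psdmx0.
have tx : forall s' Z, trivial_on s' Z -> trivial_on s' (ptrace x Z).
  move=> s' Z hZ y a b hy; have [->|nxy] := eqVneq y x.
    exact: ptrace_trivial (eqxx x).
  apply: (@ptrace_trivial_other x (pred1 y)) => //=; first by rewrite eq_sym.
  by move=> z a' b' /eqP ->; apply: hZ.
exists (ptrace x Y); split; first exact: ptrace_herm.
  move=> y a b; rewrite /= inE => /orP [/eqP ->|hy].
    exact: ptrace_trivial (eqxx x).
  exact: tx hy.
have [X1 [t1 b1]] := h x.
have -> : X - ptrace x Y = (X - X1) - ptrace x (X - X1) + ptrace x (X - Y).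
  rewrite !ptraceB (ptrace_id d0 t1) opprB !addrA subrK.
  by rewrite -!addrA; congr (_ + _); rewrite addrA addNr add0r.
have [p1 p2] := b1; have [q1 q2] := ptrace_bounded x d0 b1.
have [r1 r2] := ptrace_bounded x d0 bY.
rewrite /= doubleS -addn2 natrD; set m := (_%:R : R) in r1 r2 *.
have e2 : (K (m + 2))%:M = (K 1)%:M + (K 1)%:M + (K m)%:M :> 'M[C]_n.
  have -> : m + 2 = 1 + 1 + m by ring.
  by rewrite !rmorphD; apply/matrixP => i j; rewrite !mxE -!mulrnDl.
rewrite /bounded_by e2; split.
  have := psdmxD (psdmxD p1 q2) r1; congr psdmx.
  by rewrite !opprD !opprK [in RHS]addrACA; congr (_ + _); rewrite addrACA.
have := psdmxD (psdmxD p2 q1) r2; congr psdmx.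
by rewrite [in RHS]addrACA; congr (_ + _); rewrite addrACA.
Qed.

(** * Commuting terms and block resampling *)

Variables (g : F -> 'M[C]_n) (supp : F -> pred T) (pos : T -> nat) (r len :
  nat).
Hypothesis g_herm : forall f, (g f)^t* = g f.
Hypothesis g_comm : forall f f', g f *m g f' = g f' *m g f.
Hypothesis g_local : forall f X, trivial_on (supp f) X -> g f *m X = X *m g f.
Hypothesis g_range : forall f x y, g f != 0 -> supp f x -> supp f y ->
  (pos y <= pos x + r)%N.
Hypothesis r_gt0 : (0 < r)%N.
Hypothesis pos_lt : forall x, (pos x < len)%N.
Implicit Types (f : F) (k j l : nat) (p q : pred F).

Definition block k j : pred T := fun x => (k <= pos x < j)%N.

(** Vanishing terms are left out because [g_range] constrains only the others. *)
Definition meets k j : pred F :=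
  fun f => (g f != 0) && [exists x, supp f x && block k j x].

Definition gens k j : set 'M[C]_n :=
  [set X | (exists x a b, block k j x /\ X = e x a b) \/
           (exists2 f, meets k j f & X = g f)].

Definition local_energy p : 'M[C]_n := \sum_(f | p f) g f.

Definition boltz p : 'M[C]_n := expmx K (local_energy p).

Definition resample k j := condexp K (gens k j) (boltz (meets k j)).

Lemma gens_star k j : star_closed (gens k j).
Proof.
move=> X [[x [a [b [hx ->]]]]|[f hf ->]].
  by left; exists x, b, a; split => //; rewrite e_adj.
by right; exists f => //; rewrite g_herm.
Qed.

Lemma meetsP k j f : reflect (exists x, [/\ g f != 0, supp f x & block k j x])
  (meets k j f).
Proof.
apply: (iffP andP) => [[nz /existsP [x /andP [sx bx]]]|[x [nz sx bx]]].
  by exists x.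
by split => //; apply/existsP; exists x; rewrite sx.
Qed.

Lemma blockS k j k' j' : (k' <= k)%N -> (j <= j')%N ->
  {subset block k j <= block k' j'}.
Proof.
move=> hk hj x /andP [h1 h2]; apply/andP; split.
  exact: leq_trans h1.
exact: leq_trans hj.
Qed.

Lemma meetsS k j k' j' f : (k' <= k)%N -> (j <= j')%N ->
  meets k j f -> meets k' j' f.
Proof.
move=> hk hj /meetsP [x [nz sx bx]]; apply/meetsP; exists x; split => //.
exact: (blockS hk hj).
Qed.

Lemma commutant_gensP k j X : commutant (gens k j) X <->
  trivial_on (block k j) X /\ forall f, meets k j f -> g f *m X = X *m g f.
Proof.
split=> [h|[h1 h2] Y [[x [a [b [hx ->]]]]|[f hf ->]]].
- split=> [x a b hx|f hf]; apply: h; first by left; exists x, a, b.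
  by right; exists f.
- exact: h1.
- exact: h2.
Qed.

Lemma commutant_gensS k j k' j' X : (k' <= k)%N -> (j <= j')%N ->
  commutant (gens k' j') X -> commutant (gens k j) X.
Proof.
move=> hk hj /commutant_gensP [h1 h2]; apply/commutant_gensP; split.
  by apply: trivial_on_sub h1; exact: blockS.
by move=> f hf; apply: h2; apply: meetsS hf.
Qed.

Lemma local_energy_herm p : (local_energy p)^t* = local_energy p.
Proof. by rewrite adjmx_sum; apply: eq_bigr => f _; rewrite g_herm. Qed.

Lemma boltz_pd p : pdmx K (boltz p).
Proof. exact: expmx_pd. Qed.

Lemma local_energy_comm p X : (forall f, p f -> g f *m X = X *m g f) ->
  local_energy p *m X = X *m local_energy p.
Proof.
by move=> h; rewrite mulmx_suml mulmx_sumr; apply: eq_bigr => f /h.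
Qed.

Lemma boltz_comm p X : (forall f, p f -> g f *m X = X *m g f) ->
  boltz p *m X = X *m boltz p.
Proof.
by move=> h; apply: hfun_comm (local_energy_herm p) (local_energy_comm h).
Qed.

Lemma commutant_boltz k j p : (forall f, p f -> commutant (gens k j) (g f)) ->
  commutant (gens k j) (boltz p).
Proof.
move=> h; apply: commutant_hfun (local_energy_herm p) _.
exact: commutant_sum.
Qed.

Lemma boltz_commute p q : boltz p *m boltz q = boltz q *m boltz p.
Proof.
by apply: boltz_comm => f _; apply/esym/boltz_comm => f' _; exact: g_comm.
Qed.

Lemma boltzD p q : boltz (predU p (predD q p)) = boltz p *m boltz (predD q p).
Proof.
rewrite /boltz -expmxD ?local_energy_herm //; last first.
  by apply: local_energy_comm => f _; apply/esym/local_energy_comm => f' _.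
congr expmx; rewrite /local_energy (bigID p) /=; congr (_ + _).
  by apply: eq_bigl => f; case: (p f); rewrite /= ?andbF.
by apply: eq_bigl => f; case: (p f); case: (q f).
Qed.

Lemma boltz_split p q : {subset p <= q} -> boltz q = boltz p *m boltz (predD q
  p).
Proof.
move=> s; rewrite -boltzD; congr expmx; apply: eq_bigl => f /=.
by move: (s f : p f -> q f); case: (p f) => [->|] //; case: (q f).
Qed.

Lemma boltz_meets_comm k j W : commutant (gens k j) W ->
  boltz (meets k j) *m W = W *m boltz (meets k j).
Proof. by move=> /commutant_gensP [_ h]; apply: boltz_comm. Qed.

Lemma g_commutant k j f : ~~ meets k j f -> commutant (gens k j) (g f).
Proof.
have [g0|nz] := eqVneq (g f) 0; first by rewrite g0 => _; exact: commutant0.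
move=> nm; apply/commutant_gensP; split => [x a b hx|f' _]; last exact: g_comm.
apply/esym/g_local => y a' b' hy; apply: e_comm.
by apply: contraNneq nm => exy; apply/meetsP; exists y; split => //;
  rewrite exy.
Qed.

Lemma e_commutant k j x a b : ~~ block (k - r) (j + r) x ->
  commutant (gens k j) (e x a b).
Proof.
move=> nb; have nxy y : block (k - r) (j + r) y -> y != x.
  by apply: contraTneq => ->.
apply/commutant_gensP; split=> [y a' b' hy|f /meetsP [y [nz sy /andP [h1 h2]]]].
  apply: e_comm; apply: nxy; move: hy => /andP [h1 h2].
  by apply/andP; split; [exact: leq_trans (leq_subr _ _) h1 | exact: ltn_addr].
apply: g_local => z a' b' sz; apply: e_comm; apply: nxy; apply/andP.
have := g_range nz sy sz; have := g_range nz sz sy.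
by split; lia.
Qed.

Lemma resample_in k j X : commutant (gens k j) (resample k j X).
Proof. by apply: condexp_in; [exact: gens_star | exact: boltz_pd]. Qed.

Lemma resample_id k j X : commutant (gens k j) X -> resample k j X = X.
Proof.
by apply: condexp_id; [exact: gens_star | exact: boltz_pd | exact:
  boltz_meets_comm ].
Qed.

Lemma resample_bounded k j (c : R) X : bounded_by K c X ->
  bounded_by K c (resample k j X).
Proof.
by apply: condexp_bounded; [exact: gens_star | exact: boltz_pd | exact:
  boltz_meets_comm ].
Qed.

(** The terms that meet the larger block but not the smaller one commute with all generators of the
    smaller; their Boltzmann factor is the [R1] of [condexp_tower]. *)
Lemma resample_tower k j k' j' X : (k <= k')%N -> (j' <= j)%N ->
  resample k j (resample k' j' X) = resample k j X.
Proof.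
move=> hk hj.
apply: (condexp_tower (R1 := boltz (predD (meets k j) (meets k' j')))).
- exact: gens_star.
- exact: gens_star.
- exact: boltz_pd.
- exact: boltz_pd.
- exact: boltz_meets_comm.
- exact: boltz_meets_comm.
- by move=> W; exact: commutant_gensS.
- by apply: commutant_boltz => f /andP [nm _]; exact: g_commutant.
- by apply: boltz_split => f; exact: meetsS.
Qed.

(** * Contraction across a cut *)

Variable b : R.

Definition crosses l : pred F := fun f =>
  [&& g f != 0, [exists x, supp f x && (pos x < l)%N] &
      [exists x, supp f x && (l <= pos x)%N]].

Hypothesis cut_bound : forall l p, (forall f, p f -> crosses l f) ->
  bounded_by K b (local_energy p).

(** To the right of k such an X can act only on the strip of sites from j to j + r. Were it trivial
    there too, it would lie in the algebra of the half-line from k. *)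
Definition free_from k j X : Prop :=
  trivial_on (fun x => block k j x || (j + r <= pos x)%N) X /\
  forall f, meets k len f -> g f *m X = X *m g f.

Lemma free_fromB k j X Y : free_from k j X -> free_from k j Y ->
  free_from k j (X - Y).
Proof.
move=> [h1 h2] [h3 h4]; split; first exact: trivial_onB.
by move=> f hf; rewrite mulmxBr mulmxBl h2 ?h4.
Qed.

Lemma free_fromD k j X Y : free_from k j X -> free_from k j Y ->
  free_from k j (X + Y).
Proof.
move=> [h1 h2] [h3 h4]; split; first exact: trivial_onD.
by move=> f hf; rewrite mulmxDr mulmxDl h2 ?h4.
Qed.

Lemma free_from_scalar k j (c : C) : free_from k j c%:M.
Proof. by split; [exact: trivial_on_scalar | move=> f _;
  rewrite scalar_mxC]. Qed.

Lemma free_from_commutant k j X : (k <= j)%N ->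
  commutant (gens k len) X -> free_from k j X.
Proof.
move=> kj /commutant_gensP [h1 h2]; split=> // x a a' hx; apply: h1.
apply/andP; split; last exact: pos_lt.
by case/orP: hx => [/andP [] //|h]; apply: leq_trans h;
  exact: leq_trans (leq_addr _ _).
Qed.

Lemma free_from_resample k j Y : trivial_on (fun x => j <= pos x)%N Y ->
  (forall f, meets k len f -> meets k j f \/ g f *m Y = Y *m g f) ->
  free_from k j (resample k j Y).
Proof.
move=> tY gY.
have /commutant_gensP [h1 h2] := resample_in (k := k) (j := j) Y.
have cc u : commutant (gens k j) u -> u *m Y = Y *m u ->
    u *m resample k j Y = resample k j Y *m u.
  by apply: condexp_comm; [exact: gens_star | exact: boltz_pd | exact:
    boltz_meets_comm].
split=> [x a a' /orP [hx|hx]|f hf]; first exact: h1.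
  (* No term that meets the window reaches a site at or beyond j + r. *)
  apply: cc; first by apply: e_commutant; apply/negP => /andP [_]; lia.
  by apply: tY; exact: leq_trans (leq_addr _ _) hx.
have [m|nm] := boolP (meets k j f); first exact: h2.
by apply: cc; [exact: g_commutant | case: (gY f hf) => //; rewrite (negPf nm)].
Qed.

Definition inner k j : pred F := predD (meets k (j + r)) (meets (j + r) len).

(** The terms crossing the cut at j + r leave the weight but stay among the generators, so that
    [condexp_perturb] compares two expectations onto the same algebra. *)
Definition resample_cut k j :=
  condexp K (gens k (j + r)) (boltz (inner k j)).

Lemma boltz_inner_comm k j W : commutant (gens k (j + r)) W ->
  boltz (inner k j) *m W = W *m boltz (inner k j).
Proof.
by move=> /commutant_gensP [_ h]; apply: boltz_comm => f /andP [_ /h].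
Qed.

(* The cut expectation does not see the sites beyond the cut, so it may be
   computed with the smaller set of generators, whose commutant contains all
   the matrix units there. *)
Lemma resample_cut_in k j X : (k <= j)%N -> free_from k j X ->
  commutant (gens k len) (resample_cut k j X).
Proof.
move=> kj [tX gX].
pose G : set 'M[C]_n := [set Y | (exists x a a', block k (j + r) x /\ Y = e x a
  a') \/
  (exists2 f, inner k j f & Y = g f)].
have sG : star_closed G.
  move=> Y [[x [a [a' [hx ->]]]]|[f hf ->]].
    by left; exists x, a', a; split => //; rewrite e_adj.
  by right; exists f => //; rewrite g_herm.
have GS : G `<=` gens k (j + r).
  move=> Y [h|[f /andP [_ hf] ->]]; first by left.
  by right; exists f.
have cG W : commutant G W -> boltz (inner k j) *m W = W *m boltz (inner k j).
  by move=> h; apply: boltz_comm => f hf; apply: h; right; exists f.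
pose Y := condexp K G (boltz (inner k j)) X.
have NY : commutant G Y by apply: condexp_in => //; exact: boltz_pd.
have eY x a a' : (k <= pos x)%N -> e x a a' *m Y = Y *m e x a a'.
  move=> kx; have [lt|ge] := ltnP (pos x) (j + r).
    by apply: NY; left; exists x, a, a'; split => //; rewrite /block kx.
  apply: condexp_comm => //; [exact: boltz_pd | | by apply: tX;
    rewrite ge orbT].
  move=> u [[y [c [c' [/andP [_ hy] ->]]]]|[f /andP [nm hm] ->]].
    by apply: e_comm; apply: contraTneq hy => ->; rewrite -leqNgt.
  apply: g_local => y c c' hy; apply: e_comm.
  apply: contraNneq nm => ey; apply/meetsP; exists y.
  by split=> //; [case/andP: hm | rewrite /block ey ge pos_lt].
have gY f : meets k len f -> g f *m Y = Y *m g f.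
  move=> /meetsP [x [nz sx /andP [kx _]]].
  have [/meetsP [y [_ sy /andP [jy _]]]|nm] := boolP (meets (j + r) len f).
    apply: g_local => z a a' sz; apply: eY.
    by have := g_range nz sz sy; lia.
  apply: NY; right; exists f => //; apply/andP; split => //.
  apply/meetsP; exists x; split => //; rewrite /block kx /= ltnNge.
  apply: contra nm => jx; apply/meetsP; exists x; split => //.
  by rewrite /block jx pos_lt.
have NYlen : commutant (gens k len) Y.
  apply/commutant_gensP; split => // x a a' /andP [kx _]; exact: eY.
suff -> : resample_cut k j X = Y by [].
apply: condexp_uniq.
- exact: gens_star.
- exact: boltz_pd.
- exact: boltz_inner_comm.
- apply/commutant_gensP; split=> [x a a' /andP [kx _]|f hf]; first exact: eY.
  apply: gY; case/meetsP: hf => x [nz sx /andP [kx _]]; apply/meetsP; exists x.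
  by split => //; rewrite /block kx pos_lt.
- move=> W hW; apply: condexp_tr => //; first exact: boltz_pd.
  exact: commutantS hW.
Qed.

(** All terms missing from the cut weight cross the cut at j + r, so their sum is bounded by b
    whatever the length of the block. X commutes with both weights because it is free from k. *)
Lemma resample_lb k j X : (k <= j)%N -> free_from k j X -> psdmx X ->
  psdmx (resample k (j + r) X - K (expR (- b) ^+ 2) *: resample_cut k j X).
Proof.
move=> kj [tX gX] pX; rewrite /resample /resample_cut.
set q := meets k (j + r).
have iq : {subset inner k j <= q} by move=> f /andP [].
rewrite (boltz_split iq).
have qlen f : q f -> meets k len f.
  case/meetsP=> x [nz sx /andP [kx _]]; apply/meetsP; exists x.
  by split => //; rewrite /block kx pos_lt.
have bw : bounded_by K b (local_energy (predD q (inner k j))).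
  apply: (cut_bound (l := (j + r)%N)) => f /andP [ni hq].
  have {ni} : meets (j + r) len f.
    by apply: contraNT ni => nm; rewrite /inner /= nm.
  move=> /meetsP [x [nz sx /andP [jx _]]].
  case/meetsP: hq => y [_ sy /andP [_ yj]].
  by apply/and3P; split=> //; apply/existsP; [exists y | exists x]; apply/andP.
apply: condexp_perturb.
- exact: gens_star.
- exact: boltz_pd.
- exact: boltz_pd.
- exact: boltz_commute.
- exact: boltz_inner_comm.
- by move=> W /commutant_gensP [_ h]; apply: boltz_comm => f /andP [_ /h].
- exact: expmx_lb.
- exact: expmx_ub.
- by [].
- by apply: boltz_comm => f /andP [_ /qlen /gX].
- by apply: boltz_comm => f /andP [_ /qlen /gX].
Qed.

Definition rate : R := 1 - expR (- b) ^+ 2.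

(* A Doeblin argument: resampling dominates a multiple of the cut expectation,
   whose values lie in the smaller algebra. *)
Lemma resample_contract k j (t : R) V Z : (k <= j)%N -> free_from k j V ->
  commutant (gens k len) Z -> bounded_by K t (V - Z) ->
  exists2 Z', commutant (gens k len) Z' &
    bounded_by K (rate * t) (resample k (j + r) V - Z').
Proof.
move=> kj fV NZ [b1 b2].
have fZ := free_from_commutant kj NZ.
have NZ' : commutant (gens k (j + r)) Z.
  apply/commutant_gensP; case/commutant_gensP: NZ => h1 h2; split.
    by move=> x a a' /andP [kx _]; apply: h1; rewrite /block kx pos_lt.
  move=> f /meetsP [x [nz sx /andP [kx _]]]; apply: h2; apply/meetsP; exists x.
  by split => //; rewrite /block kx pos_lt.
set c := expR (- b) ^+ 2.
have cutD X Y : resample_cut k j (X + Y) = resample_cut k j X + resample_cut k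
  j Y.
  by apply: condexpD; exact: gens_star.
have cutB X Y : resample_cut k j (X - Y) = resample_cut k j X - resample_cut k
  j Y.
  by apply: condexpB; exact: gens_star.
have resD X Y : resample k (j + r) (X + Y) = resample k (j + r) X + resample k
  (j + r) Y.
  by apply: condexpD; exact: gens_star.
have resB X Y : resample k (j + r) (X - Y) = resample k (j + r) X - resample k
  (j + r) Y.
  by apply: condexpB; exact: gens_star.
have cuts (s : C) : resample_cut k j s%:M = s%:M.
  by apply: condexp_scalar; [exact: gens_star | exact: boltz_pd | exact:
    boltz_inner_comm].
have ress (s : C) : resample k (j + r) s%:M = s%:M.
  by apply: condexp_scalar; [exact: gens_star | exact: boltz_pd | exact:
    boltz_meets_comm].
have resZ : resample k (j + r) Z = Z by exact: resample_id.
(* Applying [resample_lb] to the positive matrices t - (V - Z) and t + (V - Z) gives exactly the two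
   bounds for this witness, with t reduced by c t. *)
exists (Z + K c *: resample_cut k j (V - Z)).
  apply: commutantD => //; apply: commutantZ; apply: resample_cut_in => //.
  exact: free_fromB.
have es : (K (rate * t))%:M = (K t)%:M - K c *: (K t)%:M :> 'M[C]_n.
  rewrite /rate -/c mulrBl mul1r rmorphB rmorphM scale_scalar_mx.
  by apply/matrixP => i i'; rewrite !mxE -mulrnBl.
have f1 : free_from k j (V - Z) by exact: free_fromB.
split.
  have := resample_lb kj (free_fromB (free_from_scalar k j (K t)) f1) b1.
  rewrite -/c resB resB ress resZ cutB cuts es; congr psdmx.
  move: (resample _ _ V) (resample_cut _ _ _) ((K t)%:M) => A B D.
  by apply/matrixP => i i'; rewrite !mxE; ring.
have := resample_lb kj (free_fromD (free_from_scalar k j (K t)) f1) b2.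
rewrite -/c resD resB ress resZ cutD cuts es; congr psdmx.
move: (resample _ _ V) (resample_cut _ _ _) ((K t)%:M) => A B D.
by apply/matrixP => i i'; rewrite !mxE; ring.
Qed.

(** The first r sites of the window only establish [free_from], with Z = 0; each further r sites
    contract once. Hence the length r (m + 1) against the exponent m. *)
Lemma resample_approx k m (t : R) Y : commutant (gens k.+1 len) Y ->
  bounded_by K t Y ->
  exists2 Z, commutant (gens k len) Z &
    bounded_by K (rate ^+ m * t) (resample k (k + r * m.+1) Y - Z) /\
    free_from k (k + r * m.+1) (resample k (k + r * m.+1) Y).
Proof.
move=> hY bY; have /commutant_gensP [tY gY] := hY.
elim: m => [|m [Z NZ [bZ fZ]]].
  exists 0; first exact: commutant0.
  rewrite expr0 mul1r subr0 muln1; split; first exact: resample_bounded.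
  apply: free_from_resample.
    by move=> x a a' hx; apply: tY; rewrite /block pos_lt andbT; lia.
  move=> f /meetsP [x [nz sx /andP [kx _]]].
  have [lt|ge] := ltnP (pos x) (k + r).
    by left; apply/meetsP; exists x; split => //; rewrite /block kx.
  right; apply: gY; apply/meetsP; exists x; split => //.
  by rewrite /block pos_lt andbT; lia.
have kj : (k <= k + r * m.+1)%N by exact: leq_addr.
have [Z' NZ' bZ'] := resample_contract kj fZ NZ bZ.
have ej : (k + r * m.+2 = k + r * m.+1 + r)%N by rewrite [(r * m.+2)%N]mulnSr
  addnA.
have eV : resample k (k + r * m.+1 + r) (resample k (k + r * m.+1) Y) =
          resample k (k + r * m.+2) Y by rewrite ej resample_tower // leq_addr.
exists Z'; first exact: NZ'.
rewrite -eV; split; first by rewrite exprS -mulrA.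
rewrite ej; apply: free_from_resample.
  by move=> x a a' hx; apply: fZ.1; rewrite hx orbT.
by move=> f hf; right; apply: fZ.2.
Qed.

(** * Mixing of windows and sweeps *)

Lemma bounded_byB (s t : R) X Y : bounded_by K s X -> bounded_by K t Y ->
  bounded_by K (s + t) (X - Y).
Proof.
move=> [h1 h2] [h3 h4].
have es : (K (s + t))%:M = (K s)%:M + (K t)%:M :> 'M[C]_n.
  by rewrite rmorphD; apply/matrixP => i i'; rewrite !mxE -mulrnDl.
rewrite /bounded_by es; split.
  have := psdmxD h1 h4; congr psdmx; move: ((K s)%:M) ((K t)%:M) => A B.
  by apply/matrixP => i i'; rewrite !mxE; ring.
have := psdmxD h2 h3; congr psdmx; move: ((K s)%:M) ((K t)%:M) => A B.
by apply/matrixP => i i'; rewrite !mxE; ring.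
Qed.

Lemma block_ge_len k j x : (len <= j)%N -> block k j x = block k len x.
Proof.
by move=> h; rewrite /block pos_lt (leq_trans (pos_lt x) h).
Qed.

Lemma resampleB k j X Y :
  resample k j (X - Y) = resample k j X - resample k j Y.
Proof. by apply: condexpB; exact: gens_star. Qed.

(** The last windows of a sweep may run past the end of the chain. *)
Lemma resample_ge_len k j X : (len <= j)%N -> resample k j X = resample k len X.
Proof.
move=> h; have em : meets k j = meets k len.
  apply/funext => f; rewrite /meets; congr (_ && _).
  by apply: eq_existsb => x; rewrite block_ge_len.
rewrite /resample em; congr (condexp K _ _ _); apply/seteqP.
by split=> Y [[x [a [a' [hx ->]]]]|[f hf ->]];
  [left; exists x, a, a'; move: hx; rewrite block_ge_len|right; exists f;
    rewrite -?em // em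
  |left; exists x, a, a'; rewrite block_ge_len|right; exists f;
    rewrite ?em // -em].
Qed.

Lemma resample_tower_right k j X :
  resample k len (resample k j X) = resample k len X.
Proof.
have [h|/ltnW h] := leqP j len; first exact: resample_tower.
by rewrite (resample_ge_len _ _ h) resample_tower.
Qed.

(** Half-line resampling fixes Z and absorbs the window resampling, so the difference is V - Z minus
    its half-line expectation, where V is the windowed observable; hence the factor 2. *)
Lemma resample_mix k m (t : R) Y :
  commutant (gens k.+1 len) Y -> bounded_by K t Y ->
  bounded_by K (rate ^+ m * t *+ 2)
    (resample k (k + r * m.+1) Y - resample k len Y).
Proof.
move=> hY bY; have [Z NZ [bZ _]] := resample_approx m hY bY.
have -> : resample k (k + r * m.+1) Y - resample k len Y =
  (resample k (k + r * m.+1) Y - Z) -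
  (resample k len (resample k (k + r * m.+1) Y - Z)).
  rewrite resampleB (resample_id NZ) resample_tower_right.
  by rewrite opprB addrA subrK.
by rewrite mulr2n; apply: bounded_byB => //; exact: resample_bounded.
Qed.

(** On observables the rightmost window acts first; dually, [run] acts on states from the left. *)
Fixpoint sweep m k s X : 'M[C]_n :=
  if s is s'.+1 then resample k (k + r * m.+1) (sweep m k.+1 s' X) else X.

Lemma bounded_byD (s t : R) X Y : bounded_by K s X -> bounded_by K t Y ->
  bounded_by K (s + t) (X + Y).
Proof.
move=> h [h3 h4]; rewrite -[Y]opprK; apply: bounded_byB => //.
by split; rewrite ?opprK.
Qed.

(* Telescoping over the sites: resampling the finite window
   [k, k + r (m + 1)) instead of everything to the right of k costs one mixing
   error per site. *)
Lemma sweep_mix m s k (t : R) X : (k + s = len)%N -> bounded_by K t X ->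
  bounded_by K ((rate ^+ m * t *+ 2) *+ s) (sweep m k s X - resample k len X).
Proof.
move=> + bX; elim: s k => [|s IHs] k ek.
  rewrite mulr0n /= resample_id.
    by rewrite subrr /bounded_by rmorph0 raddf0 /= subr0 addr0; split;
      exact: psdmx0.
  apply/commutant_gensP; split=> [x a a' /andP [h1 h2]|f /meetsP [x [_ _ /andP
    [h1 h2]]]].
    by lia.
  by lia.
rewrite /= mulrS addrC.
have -> : resample k (k + r * m.+1) (sweep m k.+1 s X) - resample k len X =
  resample k (k + r * m.+1) (sweep m k.+1 s X - resample k.+1 len X) +
  (resample k (k + r * m.+1) (resample k.+1 len X) - resample k len (resample
    k.+1 len X)).
  by rewrite resampleB [resample k len (resample _ _ _)]resample_tower // addrA
    subrK.
apply: bounded_byD.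
  by apply: resample_bounded; apply: IHs; rewrite -ek addnS addSn.
by apply: resample_mix; [exact: resample_in | exact: resample_bounded].
Qed.

(** * Entropy and transport cost along the sweep *)

Hypothesis pos_inj : injective pos.
Hypothesis d_gt0 : (0 < d)%N.
Hypothesis trivial_scalar : forall X, trivial_on predT X -> exists c, X = c%:M.
Hypothesis n_gt0 : (0 < n)%N.

Definition gibbsmx : 'M[C]_n := (\tr (boltz predT))^-1 *: boltz predT.

Lemma pdmx_tr_gt0 X : pdmx K X -> 0 < re K (\tr X).
Proof.
move=> [hX pX]; rewrite -[X](hfun_id K hX) -[hfun _ _ _]mulmx1 tr_hfun re_sum.
have e1 i : re K (K (id (ev K X i)) * (spectralmx X *m 1%:M *m (spectralmx
  X)^t*) i i) = ev K X i.
  rewrite mulmx1 (unitarymx_mulV (spectral_unitarymx X)) mxE eqxx mulr1n.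
  by rewrite mulr1 of_realK.
under eq_bigr do rewrite e1.
rewrite (bigD1 (Ordinal n_gt0)) //= ltr_wpDr // sumr_ge0 // => i _.
exact: ltW.
Qed.

Lemma psdmx_tr_real X : psdmx X -> K (re K (\tr X)) = \tr X.
Proof. by move=> hX; rewrite reK // ger0_real // psdmx_tr_ge0. Qed.

Definition partition_fun : R := re K (\tr (boltz predT)).

Lemma partition_fun_gt0 : 0 < partition_fun.
Proof. exact/pdmx_tr_gt0/boltz_pd. Qed.

Lemma gibbsmxE : gibbsmx = K partition_fun^-1 *: boltz predT.
Proof.
by rewrite /gibbsmx fmorphV psdmx_tr_real //; exact: pdmx_psd (boltz_pd _).
Qed.

Lemma gibbsmx_pd : pdmx K gibbsmx.
Proof.
rewrite gibbsmxE; apply: pdmxZ; last exact: boltz_pd.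
by rewrite invr_gt0 partition_fun_gt0.
Qed.

Lemma gibbsmx_tr : \tr gibbsmx = 1.
Proof.
rewrite /gibbsmx linearZ /= mulVf // -psdmx_tr_real;
  last exact: pdmx_psd (boltz_pd _).
by rewrite fmorph_eq0 gt_eqF // partition_fun_gt0.
Qed.

(** The terms that do not meet the block commute with its generators. One global state thus suits
    the expectations of all windows, which invariance and the entropy splitting require. *)
Lemma gibbsmx_factor k j : exists W,
  [/\ gibbsmx = boltz (meets k j) *m W, pdmx K W & commutant (gens k j) W].
Proof.
exists (K partition_fun^-1 *: boltz (predD predT (meets k j))); split.
- by rewrite -scalemxAr -boltz_split // gibbsmxE.
- by apply: pdmxZ; [rewrite invr_gt0 partition_fun_gt0 | exact: boltz_pd].
- by apply/commutantZ/commutant_boltz => f /andP [nm _]; exact: g_commutant.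
Qed.

Definition resample_dual m k rho : 'M[C]_n :=
  condexp_dual K (gens k (k + r * m.+1)) (boltz (meets k (k + r * m.+1))) rho.

Lemma resample_dualE m k rho X :
  \tr (resample_dual m k rho *m X) = \tr (rho *m resample k (k + r * m.+1) X).
Proof.
by apply: condexp_dualE; [exact: gens_star | exact: boltz_pd | exact:
  boltz_meets_comm].
Qed.

Lemma resample_dual_pd m k rho : pdmx K rho -> pdmx K (resample_dual m k rho).
Proof.
by apply: condexp_dual_pd; [exact: gens_star | exact: boltz_pd | exact:
  boltz_meets_comm].
Qed.

Lemma resample_dual_tr m k rho : \tr (resample_dual m k rho) = \tr rho.
Proof.
by apply: condexp_dual_tr; [exact: gens_star | exact: boltz_pd | exact:
  boltz_meets_comm].
Qed.

Lemma resample_gibbs k j X : \tr (gibbsmx *m resample k j X) = \tr (gibbsmx *m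
  X).
Proof.
have [W [-> _ hW]] := gibbsmx_factor k j.
apply: condexp_dual_stationary => //; [exact: gens_star | exact: boltz_pd |
  exact: boltz_meets_comm].
Qed.

Lemma resample_chain m k rho : pdmx K rho ->
  relent K rho gibbsmx =
  relent K rho (resample_dual m k rho) + relent K (resample_dual m k rho)
    gibbsmx.
Proof.
move=> pr; have [W [-> pW hW]] := gibbsmx_factor k (k + r * m.+1).
by apply: relent_chain => //; [exact: gens_star | exact: boltz_pd | exact:
  boltz_meets_comm].
Qed.

(** The form in which the Lipschitz bound is used: X can be made trivial on any set of sites at cost
    2 per site. *)
Definition lipschitz X : Prop := forall s : seq T, exists Y,
  [/\ Y^t* = Y, trivial_on (mem s) Y & bounded_by K ((size s).*2)%:R (X - Y)].

Lemma bounded_by_le (s t : R) X : s <= t -> bounded_by K s X -> bounded_by K t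
  X.
Proof.
move=> st [h1 h2].
have es : (K t)%:M = (K (t - s))%:M + (K s)%:M :> 'M[C]_n.
  by rewrite rmorphB; apply/matrixP => i i'; rewrite !mxE -mulrnDl subrK.
have p0 : psdmx ((K (t - s))%:M : 'M[C]_n).
  by apply: psdmx_scalar; rewrite of_real_ge0 subr_ge0.
by rewrite /bounded_by es -!addrA; split; apply: psdmxD.
Qed.

Lemma size_block k j : (size [seq x <- enum T | block k j x] <= j - k)%N.
Proof.
rewrite -(size_map pos) -(size_iota k (j - k)); apply: uniq_leq_size.
  by rewrite map_inj_uniq // filter_uniq // enum_uniq.
move=> i /mapP [x]; rewrite mem_filter => /andP [/andP [h1 h2] _] ->.
by rewrite mem_iota; lia.
Qed.

(** Twice the number of sites in a window enlarged by r on both sides. *)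
Definition step_cost m : R := ((r * m.+1 + r.*2).*2)%:R.

Lemma step_cost_gt0 m : 0 < step_cost m.
Proof. by rewrite ltr0n; lia. Qed.

Lemma resample_dual_cost m k rho X (t : R) : pdmx K rho -> \tr rho = 1 ->
  lipschitz X -> 0 < t ->
  re K (\tr ((rho - resample_dual m k rho) *m X)) <=
  step_cost m * (t * relent K rho (resample_dual m k rho) + t^-1).
Proof.
move=> pr tr lX t0; set rho' := resample_dual m k rho.
pose j := (k + r * m.+1)%N.
(* The margin r makes Y commute also with the terms that stick out of the window. Resampling then
   fixes Y, so X may be replaced by X - Y. *)
pose s := [seq x <- enum T | block (k - r) (j + r) x].
have [Y [hY tY bY]] := lX s.
have NY : commutant (gens k j) Y.
  apply/commutant_gensP; split=> [x a a' /andP [h1 h2]|f /meetsP [y [nz sy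
    /andP [h1 h2]]]].
    by apply: tY; rewrite /= mem_filter mem_enum andbT /block; lia.
  apply: g_local => z a a' sz; apply: tY; rewrite /= mem_filter mem_enum andbT.
  have := g_range nz sy sz; have := g_range nz sz sy.
  by rewrite /block; lia.
have e0 : \tr ((rho - rho') *m X) = \tr ((rho - rho') *m (X - Y)).
  rewrite mulmxBr [RHS]linearB /= [X in _ = _ - X](_ : _ = 0) ?subr0 //.
  by rewrite mulmxBl linearB /= resample_dualE resample_id // subrr.
rewrite e0; have pr' : pdmx K rho' by exact: resample_dual_pd.
apply: pinsker => //; first exact: pdmx_psd pr.
- exact: pdmx_psd pr'.
- by case: pr'.
- by rewrite resample_dual_tr.
- exact: step_cost_gt0.
apply: bounded_by_le bY; rewrite ler_nat leq_double.
by apply: leq_trans (size_block _ _) _; rewrite /j; lia.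
Qed.

Fixpoint run m k s rho : 'M[C]_n :=
  if s is s'.+1 then run m k.+1 s' (resample_dual m k rho) else rho.

Lemma run_dualE m s k rho X :
  \tr (run m k s rho *m X) = \tr (rho *m sweep m k s X).
Proof. by elim: s k rho => //= s IHs k rho; rewrite IHs resample_dualE. Qed.

Lemma sweep_gibbs m s k X : \tr (gibbsmx *m sweep m k s X) = \tr (gibbsmx *m X).
Proof. by elim: s k => //= s IHs k; rewrite resample_gibbs. Qed.

(** The same t serves every step, so by [resample_chain] the entropies telescope while the terms 1 /
    t add up to s / t. *)
Lemma run_cost m s k rho X (t : R) : pdmx K rho -> \tr rho = 1 ->
  lipschitz X -> 0 < t ->
  re K (\tr ((rho - run m k s rho) *m X)) <=
  step_cost m * (t * relent K rho gibbsmx + s%:R * t^-1).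
Proof.
move=> pr tr lX t0.
(* Strengthened for the induction: only the entropy lost along the run is charged, and the
   nonnegative rest is dropped at the end. *)
suff h : re K (\tr ((rho - run m k s rho) *m X)) <= step_cost m *
    (t * (relent K rho gibbsmx - relent K (run m k s rho) gibbsmx) + s%:R *
      t^-1) /\
    0 <= relent K (run m k s rho) gibbsmx.
  case: h => h1 h2; apply: le_trans h1 _; apply: ler_wpM2l.
    exact/ltW/step_cost_gt0.
  by rewrite lerD2r; apply: ler_wpM2l; [exact: ltW | rewrite lerBlDr lerDl].
elim: s k rho pr tr => [|s IHs] k rho pr tr /=.
  split; first by rewrite !subrr mul0mx linear0 re0 mulr0 mul0r addr0 mulr0.
  apply: relent_ge0 => //; [exact: pdmx_psd pr | exact: pdmx_psd gibbsmx_pd | |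
    exact: gibbsmx_tr].
  by case: gibbsmx_pd.
have pr' := resample_dual_pd m k pr.
have tr' : \tr (resample_dual m k rho) = 1 by rewrite resample_dual_tr.
have [h1 h2] := IHs k.+1 _ pr' tr'; split => //.
have h3 := resample_dual_cost m k pr tr lX t0.
rewrite (resample_chain m k pr).
have -> : rho - run m k.+1 s (resample_dual m k rho) =
  (rho - resample_dual m k rho) +
  (resample_dual m k rho - run m k.+1 s (resample_dual m k rho)).
  by rewrite addrA subrK.
rewrite mulmxDl linearD /= reD; apply: le_trans (lerD h3 h1) _.
rewrite -mulrDr; apply: ler_wpM2l; first exact/ltW/step_cost_gt0.
by rewrite -natr1 mulrDl mul1r; lra.
Qed.

Lemma card_sites : (#|T| <= len)%N.
Proof.
rewrite cardE -[enum T]filter_predT.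
have := size_block 0 len; rewrite subn0.
rewrite (_ : [seq x <- enum T | block 0 len x] = [seq x <- enum T | predT x])
  //.
by apply: eq_filter => x; rewrite /block pos_lt.
Qed.

(* X is centred by a scalar, which leaves both sides unchanged. *)
Lemma transport_cost m rho X (c t : R) : pdmx K rho -> \tr rho = 1 ->
  lipschitz X -> 0 < t -> 0 < c ->
  (rate ^+ m * (len.*2)%:R *+ 2) *+ len <= c ->
  re K (\tr ((rho - gibbsmx) *m X)) <=
  step_cost m * (t * relent K rho gibbsmx + len%:R * t^-1) +
  c * (t * relent K rho gibbsmx + t^-1).
Proof.
move=> pr tr lX t0 c0 hc; have [Y [hY tY bY]] := lX (enum T).
have [y ey] : exists y, Y = y%:M.
  by apply: trivial_scalar => x a a' _; apply: tY; rewrite /= mem_enum.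
have bX : bounded_by K (len.*2)%:R (X - Y).
  by apply: bounded_by_le bY; rewrite ler_nat leq_double -cardE card_sites.
have lXY : lipschitz (X - Y).
  move=> s; have [Z [hZ tZ bZ]] := lX s; exists (Z - Y); split.
  - by rewrite adjmxB hZ hY.
  - by apply: trivial_onB => //; rewrite ey; exact: trivial_on_scalar.
  - by rewrite opprB addrA subrK.
have tr0 (A B : 'M[C]_n) (z : C) : \tr A = \tr B -> \tr ((A - B) *m z%:M) = 0.
  by move=> eAB; rewrite mul_mx_scalar linearZ /= linearB /= eAB subrr mulr0.
have -> : \tr ((rho - gibbsmx) *m X) = \tr ((rho - gibbsmx) *m (X - Y)).
  by rewrite mulmxBr [RHS]linearB /= ey tr0 ?subr0 // tr gibbsmx_tr.
move: (X - Y) lXY bX => {lX bY ey hY tY y Y}X lX bX.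
have -> : rho - gibbsmx = (rho - run m 0 len rho) + (run m 0 len rho - gibbsmx).
  by rewrite addrA subrK.
rewrite mulmxDl linearD /= reD; apply: lerD; first exact: run_cost.
(* Resampling all sites lands in the commutant of all matrix units, the scalars. *)
have [z ez] : exists z, resample 0 len X = z%:M.
  apply: trivial_scalar => x a a' _.
  have /commutant_gensP [h _] := resample_in (k := 0) (j := len) X.
  by apply: h; rewrite /block pos_lt.
(* The sweep moves to the observable, sigma is invariant, and the scalar pairs to zero with a
   difference of states. What remains is small by [sweep_mix] and still carries the factor rho -
   sigma. *)
have -> : \tr ((run m 0 len rho - gibbsmx) *m X) =
  \tr ((rho - gibbsmx) *m (sweep m 0 len X - resample 0 len X)).
  rewrite mulmxBr [RHS]linearB /= ez tr0 ?subr0 ?tr ?gibbsmx_tr //.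
  by rewrite !mulmxBl !linearB /= run_dualE sweep_gibbs.
apply: pinsker => //; first exact: pdmx_psd pr.
- exact: pdmx_psd gibbsmx_pd.
- by case: gibbsmx_pd.
- exact: gibbsmx_tr.
- by apply: bounded_by_le hc _; apply: sweep_mix.
Qed.

End LatticeSystem.

(** * Matrix units and embeddings *)

Section Configurations.
Variables (C : numClosedFieldType) (d : nat) (T : finType).
Local Notation cfg := {ffun T -> 'I_d}.
Local Notation N := #|{ffun T -> 'I_d}|.
Implicit Types (s t u : cfg) (x y : T) (a b c : 'I_d) (X Y Z : 'M[C]_N).

Definition entry X s t : C := X (enum_rank s) (enum_rank t).

Definition mxcfg (h : cfg -> cfg -> C) : 'M[C]_N :=
  \matrix_(i, j) h (enum_val i) (enum_val j).

Lemma entry_mxcfg h s t : entry (mxcfg h) s t = h s t.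
Proof. by rewrite /entry mxE !enum_rankK. Qed.

Lemma entry_ext X Y : (forall s t, entry X s t = entry Y s t) -> X = Y.
Proof.
move=> h; apply/matrixP => i j; have := h (enum_val i) (enum_val j).
by rewrite /entry !enum_valK.
Qed.

Lemma entryM X Y s t : entry (X *m Y) s t = \sum_u entry X s u * entry Y u t.
Proof.
rewrite /entry mxE (reindex (@enum_rank cfg)) //=.
exact/onW_bij/enum_rank_bij.
Qed.

Lemma entryD X Y s t : entry (X + Y) s t = entry X s t + entry Y s t.
Proof. by rewrite /entry mxE. Qed.

Lemma entry_adj X s t : entry (X^t*) s t = Num.conj (entry X t s).
Proof. by rewrite /entry !mxE. Qed.

Lemma entry_scalar (z : C) s t : entry z%:M s t = z *+ (s == t).
Proof. by rewrite /entry mxE (inj_eq enum_rank_inj). Qed.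

Lemma entry_sum (I : Type) (r : seq I) (P : pred I) (G : I -> 'M[C]_N) s t :
  entry (\sum_(i <- r | P i) G i) s t = \sum_(i <- r | P i) entry (G i) s t.
Proof. by rewrite /entry summxE. Qed.

Lemma entryZ (z : C) X s t : entry (z *: X) s t = z * entry X s t.
Proof. by rewrite /entry mxE. Qed.

Definition upd s x a : cfg := [ffun y => if y == x then a else s y].

Lemma upd_same s x a : upd s x a x = a.
Proof. by rewrite ffunE eqxx. Qed.

Lemma upd_id s x : upd s x (s x) = s.
Proof. by apply/ffunP => y; rewrite ffunE; case: eqP => [->|]. Qed.

Lemma upd_upd s x a b : upd (upd s x a) x b = upd s x b.
Proof. by apply/ffunP => y; rewrite !ffunE; case: eqP. Qed.

Lemma updC s x y a b : x != y -> upd (upd s x a) y b = upd (upd s y b) x a.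
Proof.
move=> nxy; apply/ffunP => z; rewrite !ffunE.
by case: eqP => [->|//]; rewrite eq_sym (negPf nxy).
Qed.

Definition munit x a b : 'M[C]_N :=
  mxcfg (fun s t => ((s x == a) && (t == upd s x b))%:R).

Lemma munit_sym x a b s t :
  (s x == a) && (t == upd s x b) = (t x == b) && (s == upd t x a).
Proof.
apply/andP/andP => -[/eqP <- /eqP ->].
  by rewrite upd_same upd_upd upd_id !eqxx.
by rewrite upd_same upd_upd upd_id !eqxx.
Qed.

Lemma entry_munitM x a b X s t :
  entry (munit x a b *m X) s t = (s x == a)%:R * entry X (upd s x b) t.
Proof.
rewrite entryM (bigD1 (upd s x b)) //= entry_mxcfg eqxx andbT big1 ?addr0 //.
by move=> u nu; rewrite entry_mxcfg (negPf nu) andbF mul0r.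
Qed.

Lemma entry_Mmunit x a b X s t :
  entry (X *m munit x a b) s t = entry X s (upd t x a) * (t x == b)%:R.
Proof.
rewrite entryM (bigD1 (upd t x a)) //= entry_mxcfg munit_sym eqxx andbT big1
  ?addr0 //.
by move=> u nu; rewrite entry_mxcfg munit_sym (negPf nu) andbF mulr0.
Qed.

Lemma munit_adj x a b : (munit x a b)^t* = munit x b a.
Proof.
by apply: entry_ext => s t; rewrite entry_adj !entry_mxcfg munit_sym rmorph_nat.
Qed.

Lemma munit_mul x a b b' c :
  munit x a b *m munit x b' c = if b == b' then munit x a c else 0.
Proof.
apply: entry_ext => s t; rewrite entry_munitM entry_mxcfg upd_same upd_upd.
have [_|_] := eqVneq b b'; last by rewrite mulr0 /entry mxE.
by rewrite entry_mxcfg -natrM mulnb.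
Qed.

Lemma munit_sum x : \sum_a munit x a a = 1%:M.
Proof.
apply: entry_ext => s t; rewrite entry_sum (bigD1 (s x)) //= entry_mxcfg.
rewrite eqxx upd_id big1 ?addr0 => [|a na]; last first.
  by rewrite entry_mxcfg eq_sym (negPf na).
by rewrite entry_scalar eq_sym.
Qed.

Lemma munit_comm x y a b a' b' : x != y ->
  munit x a b *m munit y a' b' = munit y a' b' *m munit x a b.
Proof.
move=> nxy; apply: entry_ext => s t; rewrite !entry_munitM !entry_mxcfg.
have nyx : (y == x) = false by rewrite eq_sym (negPf nxy).
have -> : upd s x b y = s y by rewrite ffunE nyx.
have -> : upd s y b' x = s x by rewrite ffunE (negPf nxy).
rewrite (updC _ _ _ nxy) -!natrM !mulnb !andbA.
by rewrite [(s x == a) && _]andbC.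
Qed.

Lemma trivial_entry0 (S : pred T) Z s t x : trivial_on munit S Z -> S x ->
  s x != t x -> entry Z s t = 0.
Proof.
move=> h Sx nst; have := congr1 (fun W => entry W s t) (h x (t x) (t x) Sx).
by rewrite entry_munitM entry_Mmunit (negPf nst) mul0r eqxx mulr1 upd_id.
Qed.

Lemma trivial_entry_upd (S : pred T) Z s t x b : trivial_on munit S Z -> S x ->
  s x = t x -> entry Z s t = entry Z (upd s x b) (upd t x b).
Proof.
move=> h Sx est.
have := congr1 (fun W => entry W s (upd t x b)) (h x (s x) b Sx).
rewrite entry_munitM entry_Mmunit eqxx mul1r upd_same eqxx mulr1 upd_upd est.
by rewrite upd_id => ->.
Qed.

(** By induction on the number of sites where s and s' differ: these lie in S, and there s and t can
    be updated together without changing the entry. *)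
Lemma trivial_entry_eq (S : pred T) Z s t s' t' : trivial_on munit S Z ->
  (forall x, S x -> s x = t x) -> (forall x, S x -> s' x = t' x) ->
  (forall x, ~~ S x -> s x = s' x /\ t x = t' x) ->
  entry Z s t = entry Z s' t'.
Proof.
move=> h; have [m] := ubnP #|[pred x | s x != s' x]|.
elim: m s t => // m IHm s t lem est est' off.
case: (pickP [pred x | s x != s' x]) => [x /= nx|same].
  have Sx : S x by apply: contraNT nx => /off [->].
  rewrite (@trivial_entry_upd S Z s t x (s' x)) ?est //; apply: IHm => //.
  - apply: leq_trans (_ : _ < #|[pred x | s x != s' x]|)%N _;
    last by rewrite -ltnS.
    apply: proper_card; apply/properP; split.
      apply/fintype.subsetP => y; rewrite !inE ffunE;
        case: (eqVneq y x) => [->|//].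
      by rewrite eqxx.
    by exists x; rewrite !inE // ffunE !eqxx.
  - by move=> y Sy; rewrite !ffunE est.
  - move=> y nSy; rewrite !ffunE; case: eqP => [ey|_]; last exact: off.
    by rewrite ey Sx in nSy.
have e1 : s = s' by apply/ffunP => x; have /negbFE/eqP := same x.
rewrite -e1; congr entry; apply/ffunP => x; have [Sx|nSx] := boolP (S x).
  by rewrite -est // -est' // e1.
by have [] := off x nSx.
Qed.

Lemma trivial_munit_scalar Z : (0 < d)%N -> trivial_on munit predT Z ->
  exists z : C, Z = z%:M.
Proof.
move=> d0 h; pose s0 : cfg := [ffun=> Ordinal d0].
exists (entry Z s0 s0); apply: entry_ext => s t; rewrite entry_scalar.
case: eqP => [<-|/eqP nst]; first by rewrite mulr1n;
  apply: trivial_entry_eq h _ _ _.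
rewrite mulr0n.
have [x nx] : exists x, s x != t x.
  by apply/existsP; apply: contraR nst => /existsPn e; apply/eqP/ffunP => x;
    apply/eqP/negbNE/e.
exact: (trivial_entry0 h (x := x)).
Qed.

Lemma card_cfg_gt0 : (0 < d)%N -> (0 < N)%N.
Proof. by move=> d0; apply/card_gt0P; exists [ffun=> Ordinal d0]. Qed.

End Configurations.

Section Embedding.
Variables (R : realType) (C : numClosedFieldType) (K : real_part R C) (d : nat).
Local Notation N T := #|{ffun T -> 'I_d}|.

Definition restr (S T : finType) (f : S -> T) (s : {ffun T -> 'I_d}) :
  {ffun S -> 'I_d} := [ffun x => s (f x)].

Definition agree_off (S T : finType) (f : S -> T) (s t : {ffun T -> 'I_d}) :
  bool :=
  [forall y, (y \notin codom f) ==> (s y == t y)].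

(* embed, over an arbitrary field. *)
Definition embedmx (S T : finType) (f : S -> T) (X : 'M[C]_(N S)) : 'M[C]_(N T)
  :=
  mxcfg (fun s t => if agree_off f s t
                    then entry X (restr f s) (restr f t) else 0).

Section OneMap.
Variables (S T : finType) (f : S -> T).
Implicit Types (X Y : 'M[C]_(N S)) (Z : 'M[C]_(N T)).

Lemma agree_offP (s t : {ffun T -> 'I_d}) :
  reflect (forall y, y \notin codom f -> s y = t y) (agree_off f s t).
Proof.
apply: (iffP forallP) => [h y hy|h y].
  by apply/eqP; have := h y; rewrite hy.
by apply/implyP => /h ->.
Qed.

Lemma entry_embed X s t : entry (embedmx f X) s t =
  if agree_off f s t then entry X (restr f s) (restr f t) else 0.
Proof. by rewrite entry_mxcfg. Qed.

Lemma embed_local X Z : trivial_on (@munit C d T) (mem (codom f)) Z ->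
  embedmx f X *m Z = Z *m embedmx f X.
Proof.
move=> h; apply: entry_ext => s t; rewrite !entryM.
(* In either product a single intermediate configuration contributes: [mix t s] on the left,
   [mix s t] on the right. *)
pose mix (s t : {ffun T -> 'I_d}) : {ffun T -> 'I_d} :=
  [ffun y => if y \in codom f then s y else t y].
have restr_mix s' t' : restr f (mix s' t') = restr f s'.
  by apply/ffunP => x; rewrite !ffunE codom_f.
have mixP (s' t' u : {ffun T -> 'I_d}) : u != mix s' t' ->
    (exists2 x, x \in codom f & u x != s' x) \/ ~~ agree_off f u t'.
  move=> nu; have [ag|] := boolP (agree_off f u t'); last by right.
  left; apply/exists_inP; apply: contraR nu => /exists_inPn e.
  apply/eqP/ffunP => y; rewrite ffunE; case: ifP => hy.
    by apply/eqP/negbNE; exact: e.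
  by move/agree_offP: ag; apply; rewrite hy.
have agree_sym (s' t' : {ffun T -> 'I_d}) : agree_off f s' t' = agree_off f t'
  s'.
  by apply/agree_offP/agree_offP => e y /e.
rewrite (bigD1 (mix t s)) //= [X in _ + X]big1 => [|u /mixP [[x hx nx]|nag]];
  last first.
- by rewrite entry_embed agree_sym (negPf nag) mul0r.
- by rewrite (trivial_entry0 h hx nx) mulr0.
rewrite [RHS](bigD1 (mix s t)) //= [X in _ = _ + X]big1 => [|u /mixP [[x hx
  nx]|nag]]; last first.
- by rewrite entry_embed (negPf nag) mulr0.
- by rewrite (trivial_entry0 h (x := x) hx) ?mul0r // eq_sym.
rewrite !addr0 !entry_embed !restr_mix.
have -> : agree_off f s (mix t s).
  by apply/agree_offP => y hy; rewrite ffunE (negPf hy).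
have -> : agree_off f (mix s t) t.
  by apply/agree_offP => y hy; rewrite ffunE (negPf hy).
rewrite mulrC; congr (_ * _); apply: trivial_entry_eq h _ _ _.
- by move=> x /= hx; rewrite ffunE hx.
- by move=> x /= hx; rewrite ffunE hx.
- by move=> x /= hx; rewrite !ffunE (negPf hx).
Qed.

Lemma embed_trivial X : trivial_on (@munit C d T) (fun y => y \notin codom f)
  (embedmx f X).
Proof.
move=> y a b hy; apply/esym/embed_local => z a' b' hz; apply: munit_comm.
by apply: contraNneq hy => <-.
Qed.

Lemma embed_adj X : embedmx f (X^t*) = (embedmx f X)^t*.
Proof.
apply: entry_ext => s t; rewrite entry_adj !entry_embed entry_adj.
have -> : agree_off f s t = agree_off f t s.
  by apply/agree_offP/agree_offP => e y /e.
by case: ifP => // _; rewrite rmorph0.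
Qed.

Lemma embedD X Y : embedmx f (X + Y) = embedmx f X + embedmx f Y.
Proof.
apply: entry_ext => s t; rewrite entryD !entry_embed entryD.
by case: ifP => // _; rewrite addr0.
Qed.

Lemma embedZ (z : C) X : embedmx f (z *: X) = z *: embedmx f X.
Proof.
apply: entry_ext => s t; rewrite entryZ !entry_embed entryZ.
by case: ifP => // _; rewrite mulr0.
Qed.

Lemma embed0 : embedmx f 0 = 0.
Proof. by rewrite -(scale0r (0 : 'M_(N S))) embedZ scale0r. Qed.

Lemma embed_scalar (z : C) : embedmx f z%:M = z%:M.
Proof.
apply: entry_ext => s t; rewrite entry_embed !entry_scalar.
case: (agree_offP s t) => [ag|nag]; last first.
  by case: eqP => // est; case: nag => y _; rewrite est.
congr (_ *+ nat_of_bool _); apply/eqP/eqP => [e|->] //.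
apply/ffunP => y; have [/codomP [x ->]|/ag //] := boolP (y \in codom f).
by have /ffunP /(_ x) := e; rewrite !ffunE.
Qed.

Hypothesis f_inj : injective f.

Lemma embedM X Y : embedmx f (X *m Y) = embedmx f X *m embedmx f Y.
Proof.
apply: entry_ext => s t; rewrite entryM entry_embed.
case: (agree_offP s t) => [ag|nag]; last first.
  rewrite big1 // => u _; rewrite !entry_embed.
  case: (agree_offP s u) => [a1|_]; last by rewrite mul0r.
  case: (agree_offP u t) => [a2|_]; last by rewrite mulr0.
  by case: nag => y hy; rewrite a1 // a2.
pose ext (v : {ffun S -> 'I_d}) : {ffun T -> 'I_d} :=
  [ffun y => if [pick x | f x == y] is Some x then v x else s y].
have rK v : restr f (ext v) = v.
  apply/ffunP => x; rewrite !ffunE; case: pickP => [x' /eqP /f_inj -> //|/(_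
    x)].
  by rewrite eqxx.
have eK u : agree_off f s u -> ext (restr f u) = u.
  move=> /agree_offP au; apply/ffunP => y; rewrite ffunE.
  case: pickP => [x /eqP <-|h]; first by rewrite ffunE.
  by apply: au; apply/codomP => -[x ey]; have := h x; rewrite -ey eqxx.
have ae v : agree_off f s (ext v).
  apply/agree_offP => y hy; rewrite ffunE; case: pickP => // x /eqP ey.
  by rewrite -ey codom_f in hy.
rewrite entryM [RHS](bigID (agree_off f s)) /= [X in _ = _ + X]big1 ?addr0;
  last first.
  by move=> u nu; rewrite entry_embed (negPf nu) mul0r.
rewrite (reindex_onto ext (restr f)) /=; last exact: eK.
apply: eq_big => [v|v _]; first by rewrite ae rK eqxx.
rewrite !entry_embed ae rK; congr (_ * _).
have -> // : agree_off f (ext v) t.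
apply/agree_offP => y hy; rewrite -ag //.
by have /agree_offP -> := ae v.
Qed.

Lemma embed_herm X : X^t* = X -> (embedmx f X)^t* = embedmx f X.
Proof. by move=> h; rewrite -embed_adj h. Qed.

Lemma embed_psd X : psdmx X -> psdmx (embedmx f X).
Proof.
move=> hX; rewrite -(sqrtmxK K hX) embedM -{1}[embedmx f (sqrtmx K
  X)]embed_herm.
  exact: psdmx_gram.
exact: hfun_adj.
Qed.

Lemma embed_bounded (c : R) X : bounded_by K c X -> bounded_by K c (embedmx f
  X).
Proof.
move=> [h1 h2]; split; rewrite -(embed_scalar (K c)).
  by rewrite -scaleN1r -embedZ -embedD scaleN1r; apply: embed_psd.
by rewrite -embedD; apply: embed_psd.
Qed.

End OneMap.

Lemma embed_comp (S T U : finType) (f : S -> T) (g : T -> U) (X : 'M[C]_(N S)) :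
  injective g -> embedmx g (embedmx f X) = embedmx (g \o f) X.
Proof.
move=> gI; apply: entry_ext => s t; rewrite !entry_embed.
have rr (u : {ffun U -> 'I_d}) : restr f (restr g u) = restr (g \o f) u.
  by apply/ffunP => x; rewrite !ffunE.
rewrite !rr; case: (agree_offP (g \o f) s t) => [ag|nag].
  have -> : agree_off g s t.
    apply/agree_offP => y hy; apply: ag; apply: contra hy => /codomP [x ->].
    exact: codom_f.
  have -> // : agree_off f (restr g s) (restr g t).
  apply/agree_offP => y hy; rewrite !ffunE; apply: ag; apply: contra hy.
  by move=> /codomP [x /gI ->]; exact: codom_f.
case: (agree_offP g s t) => // a1; case: (agree_offP f) => // a2.
case: nag => y hy; have [/codomP [z ez]|] := boolP (y \in codom g);
  last exact: a1.
have := a2 z; rewrite !ffunE -ez; apply; apply: contra hy => /codomP [x ex].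
by rewrite ez ex; apply: (codom_f (g \o f)).
Qed.

Lemma eq_embed (S T : finType) (f f' : S -> T) (X : 'M[C]_(N S)) :
  f =1 f' -> embedmx f X = embedmx f' X.
Proof. by move=> /funext ->. Qed.

End Embedding.

(** * The Gibbs state of the chain *)

Section ComplexInstance.
Variable R : realType.

Lemma complex_reE (z : R[i]) : real_complex R (complex.Re z) = 'Re z.
Proof. exact: complexRe. Qed.

Definition complex_real_part : real_part R R[i] :=
  @RealPart R R[i] (real_complex R) (@complex.Re R) complex_reE (@lecR R).

Local Notation K := complex_real_part.

Lemma herm_funE (phi : R -> R) n (A : 'M[R[i]]_n) : herm_fun phi A = hfun K phi
  A.
Proof. by rewrite /hfun locked_withE. Qed.

Lemma rel_entropyE n (rho sigma : 'M[R[i]]_n) :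
  rel_entropy rho sigma = relent K rho sigma.
Proof. by rewrite /rel_entropy !herm_funE. Qed.

Lemma normcE_re (z : R[i]) : Normc.normc z ^+ 2 = complex.Re (Num.conj z * z).
Proof.
rewrite mulrC -normCK -add_Re2_Im2; case: z => x y /=.
by rewrite sqr_sqrtr // addr_ge0 // sqr_ge0.
Qed.

Lemma l2normE n (v : 'cV[R[i]]_n) :
  l2norm v = Num.sqrt (re K ((v^t* *m v) 0 0)).
Proof.
rewrite /l2norm; congr Num.sqrt; rewrite mxE (re_sum K); apply: eq_bigr => i _.
by rewrite normcE_re !mxE.
Qed.

Lemma l2norm_sqr n (v : 'cV[R[i]]_n) : l2norm v ^+ 2 = re K ((v^t* *m v) 0 0).
Proof. by rewrite l2normE sqr_sqrtr // (re_ge0 K) // cV_norm_ge0. Qed.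

Lemma l2norm_ge0 n (v : 'cV[R[i]]_n) : 0 <= l2norm v.
Proof. by rewrite l2normE sqrtr_ge0. Qed.

Lemma opnorm_ubound n (A : 'M[R[i]]_n) : A^t* = A ->
  has_ubound [set l2norm (A *m v) | v in [set v | l2norm v <= 1]].
Proof.
move=> hA; have [c c0 hc] := bounded_by_exists K hA; exists c => _ [v /= hv <-].
rewrite -(ler_sqr _ c0) ?nnegrE ?l2norm_ge0 // l2norm_sqr adjmxM hA.
have := re_ge0 K (bounded_by_sqr hc v).
rewrite mulmxBr mulmxBl !mulmxA mul_mx_scalar -scalemxAl.
rewrite mxE [X in re K (X + _)]mxE [X in re K (_ + X)]mxE (reB K) (reZ K)
  subr_ge0.
move=> h; apply: le_trans h _; rewrite -[leRHS]mulr1; apply: ler_wpM2l.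
  exact: sqr_ge0.
by rewrite -l2norm_sqr expr_le1 ?l2norm_ge0.
Qed.

Lemma opnorm_bounded n (A : 'M[R[i]]_n) (c : R) : A^t* = A -> opnorm A <= c ->
  bounded_by K c A.
Proof.
move=> hA hc.
apply: bounded_by_of_ev => // i.
(* A unit eigenvector, on which A v has as norm the absolute value of the eigenvalue. *)
pose v : 'cV[R[i]]_n := (spectralmx A)^t* *m delta_mx i 0.
have dd : ((delta_mx i 0 : 'cV[R[i]]_n)^t* *m (delta_mx i 0 : 'cV_n)) 0 0 = 1.
  by rewrite trmx_delta map_delta_mx mul_delta_mx mxE !eqxx.
have vv : (v^t* *m v) 0 0 = 1.
  rewrite /v adjmxM trmxCK !mulmxA -[X in X *m _]mulmxA.
  by rewrite (unitarymx_mulV (spectral_unitarymx A)) mulmx1.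
have Av : A *m v = K (ev K A i) *: v.
  rewrite [in LHS](spectralE K hA) /v mulmxA (mulmxtVK _ (spectral_unitarymx
    A)).
  rewrite -mulmxA [RHS]scalemxAr; congr mulmx.
  apply/matrixP => k l; rewrite rdiag_mulmx !mxE; case: eqP => [->|_] //=.
  by rewrite !mulr0.
have nv : l2norm v = 1 by rewrite l2normE vv (_ : re K 1 = 1) ?sqrtr1.
apply: le_trans hc; apply: le_trans (ub_le_sup (opnorm_ubound hA) _);
  last first.
  by exists v => //=; rewrite nv.
rewrite Av l2normE adjmxZr -scalemxAl -scalemxAr scalerA mxE -(rmorphM K) (reZ
  K) vv.
by rewrite (_ : re K 1 = 1) // mulr1 -expr2 sqrtr_sqr.
Qed.

Lemma embedE d (S T : finType) (f : S -> T) (X : op R d S) :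
  embed f X = embedmx f X.
Proof. by []. Qed.

Lemma opnorm_ge0 n (A : 'M[R[i]]_n) : A^t* = A -> 0 <= opnorm A.
Proof.
move=> hA; apply: le_trans (ub_le_sup (opnorm_ubound hA) _); last first.
  by exists 0 => //=; rewrite l2normE mulmx0 mxE (re0 K) sqrtr0.
exact: l2norm_ge0.
Qed.

End ComplexInstance.

(** * Counting the terms across a cut *)

Section CutCount.
Variables (R : realType) (C : numClosedFieldType) (K : real_part R C).
Variables (n : nat) (T F : finType).
Variables (g : F -> 'M[C]_n) (supp : F -> pred T) (pos : T -> nat) (r : nat).
Hypothesis g_range : forall f x y, g f != 0 -> supp f x -> supp f y ->
  (pos y <= pos x + r)%N.
Hypothesis pos_inj : injective pos.
Hypothesis supp_inj : forall f f', supp f =1 supp f' -> f = f'.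

(** A crossing term has its support within distance r of the cut, among at most 2 r sites, and
    distinct terms have distinct supports. *)
Lemma card_crosses l : (#|[pred f | crosses g supp pos l f]| <= 2 ^ (r + r))%N.
Proof.
pose W := [set x | (l - r <= pos x < l + r)%N]%SET.
have cW : (#|W| <= r + r)%N.
  rewrite cardE -(size_map pos) -(size_iota (l - r) (r + r)).
  apply: uniq_leq_size; first by rewrite map_inj_uniq // enum_uniq.
  move=> i /mapP [x]; rewrite mem_enum inE => /andP [h1 h2] ->.
  by rewrite mem_iota; lia.
apply: leq_trans (_ : 2 ^ #|W| <= _)%N; last by rewrite leq_exp2l.
rewrite -card_powerset.
pose phi f := [set x | supp f x]%SET.
have phiI : injective phi.
  by move=> f f' /setP e; apply: supp_inj => x; have := e x; rewrite !inE.
rewrite -(card_imset _ phiI); apply: subset_leq_card.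
apply/fintype.subsetP => _ /imsetP [f /and3P [nz /existsP [y /andP [sy hy]]
  /existsP [z /andP [sz hz]]] ->].
rewrite inE; apply/fintype.subsetP => x; rewrite !inE => sx.
have := g_range nz sy sx; have := g_range nz sx sz.
by lia.
Qed.

Lemma local_energy_bounded (c : R) (p : pred F) : 0 <= c ->
  (forall f, p f -> bounded_by K c (g f)) -> forall m, (#|p| <= m)%N ->
  bounded_by K (c *+ m) (local_energy g p).
Proof.
move=> c0 h m hm; apply: bounded_by_le (_ : c *+ #|p| <= _) _.
  by rewrite -(subnK hm) mulrnDr lerDr mulrn_wge0.
rewrite -sumr_const /local_energy.
rewrite (eq_bigl p) //.
apply: (big_ind2 (fun s X => bounded_by K s X)) => //.
  rewrite /bounded_by rmorph0 raddf0 subr0 addr0; split; exact: psdmx0.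
by move=> s1 X1 s2 X2; exact: bounded_byD.
Qed.

End CutCount.

Section InteractionInstance.
Variables (R : realType) (d : nat) (h : interaction R d) (r : nat) (J beta : R).
Hypothesis d_gt0 : (0 < d)%N.
Hypothesis h_herm : self_adjoint h.
Hypothesis h_range : finite_range r h.
Hypothesis h_comm : commuting h.
Hypothesis h_le : strength_le J h.
Hypothesis beta_gt0 : 0 < beta.
Local Notation K := (complex_real_part R).

Lemma J_ge0 : 0 <= J.
Proof.
apply: le_trans (h_le fset0); apply: opnorm_ge0.
by apply/hermsymmxE; exact: h_herm.
Qed.

Section Chain.
Variable len : nat.
Local Notation L := (chain len).

Definition site_pos (x : L) : nat := (`|val x|%N).-1.

Lemma chainP (x : int) : x \in L -> exists2 k, (0 < k <= len)%N & x = k%:Z.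
Proof.
move=> /imfsetP [k /= hk ->]; exists k => //.
by move: hk; rewrite mem_iota; lia.
Qed.

Lemma site_posE (x : L) : val x = (site_pos x).+1%:Z.
Proof.
have [k /andP [k0 _] e] := chainP (valP x).
by rewrite /site_pos e absz_nat prednK.
Qed.

Lemma site_pos_inj : injective site_pos.
Proof. by move=> x y e; apply: val_inj; rewrite !site_posE e. Qed.

Lemma site_pos_lt x : (site_pos x < len)%N.
Proof.
have [k /andP [k0 kl] e] := chainP (valP x).
by rewrite /site_pos e absz_nat prednK.
Qed.

(** The factor - beta sits inside the terms, so that [boltz predT] is the unnormalised Gibbs
    weight. *)
Definition term (A : fpowerset L) : 'M[R[i]]_#|{ffun L -> 'I_d}| :=
  K (- beta) *: embedmx (fincl (subset_subproof A)) (h (val A)).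

Definition term_supp (A : fpowerset L) : pred L := fun x => val x \in val A.

Lemma codom_fincl (A B : {fset int}) (AB : (A `<=` B)%fset) (x : B) :
  (x \in codom (fincl AB)) = (val x \in A).
Proof.
apply/codomP/idP => [[y ->]|hx]; first exact: (fsvalP y).
by exists [` hx]%fset; apply: val_inj.
Qed.

Lemma fincl_inj (A B : {fset int}) (AB : (A `<=` B)%fset) : injective (fincl
  AB).
Proof. by move=> x y /(congr1 val) /= e; apply: val_inj. Qed.

Lemma term_herm A : (term A)^t* = term A.
Proof.
rewrite /term (adjmxZr K) -embed_adj.
by congr (_ *: embedmx _ _); apply/hermsymmxE; exact: h_herm.
Qed.

Lemma term_comm A B : term A *m term B = term B *m term A.
Proof.
rewrite /term -!scalemxAl -!scalemxAr; congr (_ *: (_ *: _)).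
have sU : (val A `|` val B `<=` L)%fset by rewrite fsubUset !subset_subproof.
have eA : embedmx (fincl (subset_subproof A)) (h (val A)) =
    embedmx (fincl sU) (embedmx (fincl (fsubsetUl (val A) (val B))) (h (val
      A))).
  rewrite embed_comp; last exact: fincl_inj.
  by apply: eq_embed => x; apply: val_inj.
have eB : embedmx (fincl (subset_subproof B)) (h (val B)) =
    embedmx (fincl sU) (embedmx (fincl (fsubsetUr (val A) (val B))) (h (val
      B))).
  rewrite embed_comp; last exact: fincl_inj.
  by apply: eq_embed => x; apply: val_inj.
rewrite eA eB -!embedM; try exact: fincl_inj.
by congr embedmx; exact: h_comm.
Qed.

Lemma term_local A X : trivial_on (@munit R[i] d L) (term_supp A) X ->
  term A *m X = X *m term A.
Proof.
move=> hX; rewrite /term -scalemxAl -scalemxAr; congr (_ *: _).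
apply: embed_local; apply: trivial_on_sub hX => x.
by rewrite -!topredE /= codom_fincl.
Qed.

(** The range is given as r + 1 so that it is positive even for r = 0, as the lattice section
    demands. *)
Lemma term_range A x y : term A != 0 -> term_supp A x -> term_supp A y ->
  (site_pos y <= site_pos x + r.+1)%N.
Proof.
move=> nz hx hy; rewrite leqNgt; apply/negP => lt.
move/eqP: nz; apply; rewrite /term h_range ?embed0 ?scaler0 //.
by exists (val x), (val y); split => //; rewrite !site_posE; lia.
Qed.

Lemma term_supp_inj A B : term_supp A =1 term_supp B -> A = B.
Proof.
move=> e; apply: val_inj; apply/fsetP => x; apply/idP/idP => hx.
  have xL := fsubsetP (subset_subproof A) x hx.
  by have := e [` xL]%fset; rewrite /term_supp /= hx => <-.
have xL := fsubsetP (subset_subproof B) x hx.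
by have := e [` xL]%fset; rewrite /term_supp /= hx => ->.
Qed.

Lemma term_bounded A : bounded_by K (beta * J) (term A).
Proof.
have /hermsymmxE hh := h_herm (val A).
rewrite /term (rmorphN K) scaleNr; apply/bounded_byN/bounded_byZ;
  first exact: ltW.
apply: embed_bounded; first exact: fincl_inj.
exact: (opnorm_bounded hh (h_le _)).
Qed.

(** Each term is bounded by beta J, and [card_crosses] is taken at range r + 1; the chain length
    does not enter. *)
Definition cut_strength : R := (beta * J) *+ 2 ^ (r.+1 + r.+1).

Lemma term_cut_bound l (p : pred (fpowerset L)) : (forall A, p A -> crosses
  term term_supp site_pos l A) ->
  bounded_by K cut_strength (local_energy term p).
Proof.
move=> hp; apply: local_energy_bounded.
- by rewrite mulr_ge0 ?J_ge0 // ltW.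
- by move=> A _; exact: term_bounded.
apply: leq_trans (card_crosses term_range site_pos_inj term_supp_inj l).
by apply: subset_leq_card; apply/fintype.subsetP => A /hp.
Qed.

Lemma gibbs_term : gibbs beta (hamiltonian h L) = gibbsmx K term.
Proof.
have e : local_energy term predT = - (K beta *: hamiltonian h L).
  rewrite /hamiltonian scaler_sumr -sumrN; apply: eq_bigr => A _.
  by rewrite /term (rmorphN K) scaleNr.
by rewrite /gibbs herm_funE /gibbsmx /boltz /expmx e.
Qed.

Lemma lip_const_approx (H : op R d L) (x : L) : H^t* = H -> lip_const H <= 1 ->
  exists Y, trivial_on (@munit R[i] d L) (pred1 x) Y /\ bounded_by K 1 (H - Y).
Proof.
move=> hH; rewrite /lip_const => lH.
set S := fun i : L => [set opnorm (H - X) |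
  X in [set X : op R d L | X \is hermsymmx /\ not_acting_on i X]].
(* The factor 2 in [lip_const] leaves the infimum at most 1/2. The slack up to 1 provides an
   approximant without the infimum being attained. *)
have h1 : inf (S x) < 1.
  apply: (@le_lt_trans _ _ (\big[Num.max/0]_(i : L) inf (S i))).
    exact: (le_bigmax 0 (fun i => inf (S i)) x).
  by move: lH; rewrite -/S => lH; lra.
have S0 : S x !=set0.
  exists (opnorm (H - 0)), 0 => //; split.
    by apply/hermsymmxE; rewrite trmx0 map_mx0.
  by exists 0; rewrite embedE embed0.
have [_ [Y [/hermsymmxE hY [Z eY]] <-] lt1] := inf_lt S0 h1.
exists Y; split.
  rewrite eY embedE => y a b /eqP ->; apply: embed_trivial.
  by apply/codomP => -[[z nz] /= ez]; rewrite ez eqxx in nz.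
apply: opnorm_bounded; last exact: ltW.
by rewrite adjmxB hH hY.
Qed.

Lemma lip_const_lipschitz (H : op R d L) : H^t* = H -> lip_const H <= 1 ->
  lipschitz K (@munit R[i] d L) H.
Proof.
move=> hH lH s; apply: trivial_on_approx.
- exact: munit_adj.
- exact: munit_mul.
- exact: munit_sum.
- exact: munit_comm.
- exact: d_gt0.
- exact: hH.
- by move=> x; exact: lip_const_approx.
Qed.

Lemma gibbs_transport m (rho H : op R d L) (c t : R) :
  pdmx K rho -> \tr rho = 1 -> H^t* = H -> lip_const H <= 1 -> 0 < t -> 0 < c ->
  (rate cut_strength ^+ m * (len.*2)%:R *+ 2) *+ len <= c ->
  re K (\tr ((rho - gibbs beta (hamiltonian h L)) *m H)) <=
  step_cost R r.+1 m *
    (t * relent K rho (gibbs beta (hamiltonian h L)) + len%:R * t^-1) +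
  c * (t * relent K rho (gibbs beta (hamiltonian h L)) + t^-1).
Proof.
move=> pr tr hH lH t0 c0 hc; rewrite gibbs_term.
apply: (@transport_cost R _ K _ d L _ (@munit R[i] d L) _ _ term term_supp
  site_pos r.+1 len _ _ _ _ _ _ cut_strength).
- exact: munit_adj.
- exact: munit_comm.
- exact: term_herm.
- exact: term_comm.
- exact: term_local.
- exact: term_range.
- by [].
- exact: site_pos_lt.
- exact: term_cut_bound.
- exact: site_pos_inj.
- exact: d_gt0.
- by move=> X; exact: trivial_munit_scalar.
- exact: card_cfg_gt0.
- exact: pr.
- exact: tr.
- exact: lip_const_lipschitz.
- exact: t0.
- exact: c0.
- exact: hc.
Qed.

End Chain.

End InteractionInstance.

Section Mixing.
Variables (R : realType) (C : numClosedFieldType) (K : real_part R C) (n : nat).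
Implicit Types (rho sigma : 'M[C]_n).

(* Klein's inequality, applied to the two components of the mixture. *)
Lemma relent_mix rho sigma (eps : R) : psdmx rho -> pdmx K sigma ->
  \tr rho = 1 -> \tr sigma = 1 -> 0 < eps -> eps < 1 ->
  let rho' := K (1 - eps) *: rho + K eps *: sigma in
  [/\ pdmx K rho', \tr rho' = 1 &
      relent K rho' sigma <= (1 - eps) * relent K rho sigma].
Proof.
move=> pr ps tr ts e0 e1 rho'.
have pr' : pdmx K rho'.
  apply: pdmxD; last exact: pdmxZ.
  by apply: psdmxZ => //; rewrite of_real_ge0 subr_ge0 ltW.
have tr' : \tr rho' = 1.
  by rewrite linearD !linearZ /= tr ts !mulr1 -rmorphD subrK rmorph1.
split => //.
pose f (X Y : 'M[C]_n) := re K (\tr (X *m lnmx K Y)).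
have relE (X Y : 'M[C]_n) : relent K X Y = f X X - f X Y by rewrite /relent
  linearB /= reB.
have fl (Y : 'M[C]_n) : f rho' Y = (1 - eps) * f rho Y + eps * f sigma Y.
  by rewrite /f mulmxDl -!scalemxAl linearD !linearZ /= reD !reZ.
have k1 : 0 <= relent K rho rho'.
  by apply: relent_ge0 => //; [exact: pdmx_psd pr' | case: pr'].
have k2 : 0 <= relent K sigma rho'.
  by apply: relent_ge0 => //; [exact: pdmx_psd ps | exact: pdmx_psd pr' | case:
    pr'].
move: k1 k2; rewrite !relE !fl => k1 k2.
have := mulr_ge0 (ltW e0) k2.
have e1' : 0 <= 1 - eps by rewrite subr_ge0 ltW.
by have := mulr_ge0 e1' k1; lra.
Qed.

End Mixing.

(** * Elementary estimates for the constants *)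

Section Numerics.
Variable R : realType.

Lemma optimise_t (T D A N : R) : 0 <= D -> 0 < A -> 0 <= N ->
  (forall t, 0 < t -> T <= A * (t * D + N * t^-1)) ->
  T <= Num.sqrt (4 * A ^+ 2 * N * D).
Proof.
move=> D0 A0 N0 h; have [T0|T0] := leP T 0.
  by apply: le_trans T0 _; exact: sqrtr_ge0.
rewrite -(ger0_norm (ltW T0)) -sqrtr_sqr ler_wsqrtr //.
have [D1|D1] := eqVneq D 0.
  (* For D = 0 this t is large enough to make the bound smaller than T, a contradiction. *)
  have t0 : 0 < (2 * A * N + 1) / T.
    by rewrite divr_gt0 // ltr_wpDl // !mulr_ge0 // ltW.
  have B0 : 0 < 2 * A * N + 1 by rewrite ltr_wpDl // !mulr_ge0 // ltW.
  have := h _ t0; rewrite D1 mulr0 add0r invf_div.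
  have -> : A * (N * (T / (2 * A * N + 1))) = T * (A * N / (2 * A * N + 1)).
    by field; rewrite gt_eqF.
  have q1 : A * N / (2 * A * N + 1) < 1.
    by rewrite ltr_pdivrMr // mul1r; have := mulr_ge0 (ltW A0) N0; lra.
  by rewrite -{1}[T]mulr1 ler_pM2l // leNgt q1.
have Dp : 0 < D by rewrite lt_neqAle eq_sym D1.
(* With this t the bound reads T <= T / 2 + 2 A^2 N D / T, so no square root has to be handled. *)
have t0 : 0 < T / (2 * A * D) by rewrite divr_gt0 // !mulr_gt0.
have := h _ t0; rewrite invf_div.
have -> : A * (T / (2 * A * D) * D + N * (2 * A * D / T)) =
  (T ^+ 2 / 2 + 2 * A ^+ 2 * N * D) / T by field; rewrite !gt_eqF.
by rewrite ler_pdivlMr // -expr2; lra.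
Qed.

Lemma le_of_scaled (T B : R) : 0 <= B ->
  (forall e, 0 < e -> e < 1 -> (1 - e) * T <= B) -> T <= B.
Proof.
move=> B0 h; rewrite leNgt; apply/negP => lt.
have T0 : 0 < T by exact: le_lt_trans lt.
have e0 : 0 < (T - B) / (2 * T) by rewrite divr_gt0 ?subr_gt0 // mulr_gt0.
have e1 : (T - B) / (2 * T) < 1.
  by rewrite ltr_pdivrMr ?mulr_gt0 // mul1r; lra.
have := h _ e0 e1; have -> : (1 - (T - B) / (2 * T)) * T = (T + B) / 2.
  by field; rewrite gt_eqF.
by lra.
Qed.

Lemma pow_le_expR (q : R) m : q <= 1 -> (1 - q) ^+ m <= expR (- (q * m%:R)).
Proof.
move=> q1; rewrite mulrC -mulrN expRM_natl; apply: lerXn2r.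
- by rewrite nnegrE subr_ge0.
- by rewrite nnegrE expR_ge0.
- by have := expR_ge1Dx (- q).
Qed.

(** The n window errors, each proportional to the norm bound 2 n, add up to 4 n^2 (1 - q)^m. Any m
    above 2 ln n / q makes the power at most n^-2. *)
Lemma sweep_length (q : R) n : 0 < q -> q <= 1 -> (2 <= n)%N ->
  exists2 m : nat, m%:R <= 2 * ln n%:R / q + 1 &
    ((1 - q) ^+ m * (n.*2)%:R *+ 2) *+ n <= 4.
Proof.
move=> q0 q1 n2; have n0 : 0 < n%:R :> R by rewrite ltr0n; lia.
have l0 : 0 <= ln (n%:R : R) by rewrite ln_ge0 // ler1n; lia.
pose x : R := 2 * ln n%:R / q.
have x0 : 0 <= x by rewrite divr_ge0 ?mulr_ge0 // ltW.
exists (Num.truncn x).+1.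
  by rewrite -natr1 lerD2r; have /andP [] := truncn_itv x0.
have /andP [_ hx] := truncn_itv x0.
have : (1 - q) ^+ (Num.truncn x).+1 <= (n%:R ^+ 2)^-1.
  apply: le_trans (pow_le_expR _ q1) _.
  have -> : (n%:R ^+ 2)^-1 = expR (- (2 * ln n%:R)) :> R.
    by rewrite expRN mulr_natl -lnXn // lnK // posrE exprn_gt0.
  rewrite ler_expR lerN2; apply: le_trans (_ : q * x <= _).
    by rewrite [q * x]mulrC /x divfK // gt_eqF.
  by rewrite ler_pM2l // ltW.
move: (_ ^+ _.+1) => y hy.
have -> : y * n.*2%:R *+ 2 *+ n = 4 * (y * n%:R ^+ 2).
  by rewrite -[_ *+ 2 *+ n]mulr_natr -[_ *+ 2]mulr_natr -muln2 natrM; ring.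
rewrite -[leRHS]mulr1 ler_pM2l //.
by rewrite -ler_pdivlMr ?exprn_gt0 // mul1r.
Qed.

Lemma ln2_gt0 : 0 < ln 2 :> R.
Proof. by rewrite ln_gt0 // ltr1n. Qed.

Lemma ln2_le n : (2 <= n)%N -> ln 2 <= ln n%:R :> R.
Proof.
by move=> n2; rewrite ler_ln ?posrE ?ltr0n ?ler_nat //; exact: leq_trans n2.
Qed.

(** The first summand is [step_cost] for x = r + 1, and 4 is the Pinsker constant of the final
    error. As l >= ln 2, additive constants are absorbed into the multiple of l. *)
Lemma slope_bound (x m l q : R) : 1 <= x -> 0 < q -> ln 2 <= l ->
  m <= 2 * l / q + 1 ->
  2 * x * (m + 3) + 4 <= 2 * x * (2 / q + 6 / ln 2) * l.
Proof.
move=> x1 q0 l2 hm; have x0 : 0 <= 2 * x by lra.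
apply: (@le_trans _ _ (2 * x * (m + 5))).
  have -> : 2 * x * (m + 5) = 2 * x * (m + 3) + 4 * x by ring.
  by rewrite lerD2l; lra.
rewrite -[leRHS]mulrA; apply: ler_wpM2l => //.
have l6 : 6 <= 6 / ln 2 * l by rewrite mulrAC ler_pdivlMr ?ln2_gt0 // ler_pM2l.
by rewrite mulrDl [2 / q * _]mulrAC; lra.
Qed.

End Numerics.

(** * The transport constant *)

Section TransportConstant.
Variables (R : realType) (d : nat) (h : interaction R d) (r : nat) (J beta : R).
Hypothesis d_gt0 : (0 < d)%N.
Hypothesis h_herm : self_adjoint h.
Hypothesis h_range : finite_range r h.
Hypothesis h_comm : commuting h.
Hypothesis h_le : strength_le J h.
Hypothesis beta_gt0 : 0 < beta.
Local Notation K := (complex_real_part R).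

Let q : R := expR (- cut_strength r J beta) ^+ 2.

Let q_gt0 : 0 < q.
Proof. by rewrite exprn_gt0 // expR_gt0. Qed.

Let q_le1 : q <= 1.
Proof.
rewrite expr_le1 ?expR_ge0 // -[leRHS]expR0 ler_expR oppr_le0 /cut_strength.
by rewrite mulrn_wge0 // mulr_ge0 ?(J_ge0 h_herm h_le) // ltW.
Qed.

Definition slope : R := 2 * r.+1%:R * (2 / q + 6 / ln 2).

Lemma slope_gt0 : 0 < slope.
Proof.
rewrite mulr_gt0 ?mulr_gt0 ?ltr0n //.
by rewrite addr_gt0 // divr_gt0 // ln2_gt0.
Qed.

Lemma gibbs_pd n : pdmx K (gibbs beta (hamiltonian h (chain n))).
Proof. by rewrite gibbs_term; apply: gibbsmx_pd; exact: card_cfg_gt0. Qed.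

Lemma gibbs_tr n : \tr (gibbs beta (hamiltonian h (chain n))) = 1.
Proof. by rewrite gibbs_term; apply: gibbsmx_tr; exact: card_cfg_gt0. Qed.

Lemma transport_linear n (rho H : op R d (chain n)) (t : R) : (2 <= n)%N ->
  pdmx K rho -> \tr rho = 1 -> H^t* = H -> lip_const H <= 1 -> 0 < t ->
  re K (\tr ((rho - gibbs beta (hamiltonian h (chain n))) *m H)) <=
    slope * ln n%:R *
    (t * relent K rho (gibbs beta (hamiltonian h (chain n))) + n%:R * t^-1).
Proof.
move=> n2 pr tr hH lH t0.
(* Here 1 - q is [rate] at the cut strength, so [hc] is the smallness hypothesis of
   [gibbs_transport] with c = 4. *)
have [m hm hc] := sweep_length q_gt0 q_le1 n2.
have c0 : 0 < 4 :> R by rewrite ltr0n.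
have := gibbs_transport d_gt0 h_herm h_range h_comm h_le beta_gt0 pr tr hH lH
  t0 c0 hc.
move: (gibbs _ _) (gibbs_pd n) (gibbs_tr n) => sigma ps ts le1.
have D0 : 0 <= relent K rho sigma.
  apply: relent_ge0; [exact: pdmx_psd pr | exact: pdmx_psd ps | by case: ps
    | exact: tr | exact: ts].
have le2 : step_cost R r.+1 m + 4 <= slope * ln n%:R.
  have -> : step_cost R r.+1 m = 2 * r.+1%:R * (m%:R + 3).
    by rewrite /step_cost -muln2 natrM natrD -addnn natrD natrM -natr1; ring.
  by apply: slope_bound; [rewrite ler1n | exact: q_gt0 | exact: ln2_le | exact:
    hm].
move: (re K _) (relent _ _ _) (step_cost _ _ _) (slope * _) le1 D0 le2 => T D s
  A le1 D0 le2.
have ti : 0 < t^-1 by rewrite invr_gt0.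
have n1 : 1 <= n%:R :> R by rewrite ler1n; exact: ltnW.
have le3 : t * D + t^-1 <= t * D + n%:R * t^-1.
  by rewrite lerD2l -{1}[t^-1]mul1r; apply: ler_wpM2r => //; exact: ltW.
apply: (le_trans le1); apply: le_trans (lerD (lexx _) (ler_wpM2l (ltW c0) le3))
  _.
rewrite -mulrDl; apply: ler_wpM2r => //.
by apply: le_trans le3; apply: addr_ge0; [exact: mulr_ge0 (ltW t0) D0 | exact:
  ltW].
Qed.

Lemma transport_gaussian n (rho H : op R d (chain n)) : (2 <= n)%N ->
  psdmx rho -> \tr rho = 1 -> H^t* = H -> lip_const H <= 1 ->
  re K (\tr ((rho - gibbs beta (hamiltonian h (chain n))) *m H)) <=
    Num.sqrt (4 * (slope * ln n%:R) ^+ 2 * n%:R *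
              relent K rho (gibbs beta (hamiltonian h (chain n)))).
Proof.
move=> n2 pr tr hH lH.
have lin rho' t (pr' : pdmx K rho') (tr' : \tr rho' = 1) (t0 : 0 < t) :=
  transport_linear n2 pr' tr' hH lH t0.
move: (gibbs _ _) (gibbs_pd n) (gibbs_tr n) lin => sigma ps ts lin.
have D0 : 0 <= relent K rho sigma.
  apply: relent_ge0; [exact: pr | exact: pdmx_psd ps | by case: ps
    | exact: tr | exact: ts].
have A0 : 0 < slope * ln n%:R.
  by apply: mulr_gt0; [exact: slope_gt0 | apply: lt_le_trans (ln2_le R n2);
    exact: ln2_gt0].
apply: optimise_t => [|||t t0]; [exact: D0 | exact: A0 | exact: ler0n |].
have B0 : 0 <= t * relent K rho sigma + n%:R * t^-1.
  apply: addr_ge0; first by apply: mulr_ge0; [exact: ltW | exact: D0].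
  by apply: mulr_ge0; [exact: ler0n | rewrite invr_ge0 ltW].
(* The linear bound requires a definite state. Mixing rho with sigma scales the left side by 1 - eps
   and does not increase the entropy, and eps is arbitrary. *)
apply: le_of_scaled => [|eps e0 e1]; first by apply: mulr_ge0;
  [exact: ltW | exact: B0].
have [pr' tr' le] := relent_mix pr ps tr ts e0 e1.
have := lin _ t pr' tr' t0.
move: pr' tr' le; set rho' := K (1 - eps) *: rho + _ => pr' tr' le.
have -> : rho' - sigma = K (1 - eps) *: (rho - sigma).
  rewrite /rho' scalerBr -addrA; congr (_ + _); rewrite (rmorphB K) (rmorph1 K).
  by rewrite scalerBl scale1r opprB addrC.
rewrite -scalemxAl mxtraceZ (reZ K) => le1; apply: le_trans le1 _.
apply: ler_wpM2l; first exact: ltW.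
apply: lerD; last exact: lexx.
apply: ler_wpM2l; first exact: ltW.
apply: le_trans le _; apply: ler_piMl; first exact: D0.
by rewrite lerBlDr lerDl; exact: ltW.
Qed.

End TransportConstant.

Theorem proposition1p3 (R : realType) (d : nat) (h : interaction R d)
    (r : nat) (J beta : R) :
  (0 < d)%N ->
  self_adjoint h -> finite_range r h -> commuting h ->
  translation_invariant h -> strength_le J h -> 0 < beta ->
  exists C : nat -> R,
    O_n_polylog C /\
    forall n : nat, (2 <= n)%N ->
      let sigma : op R d (chain n) := gibbs beta (hamiltonian h (chain n)) in
      forall rho : op R d (chain n), density rho ->
        W1 rho sigma <= Num.sqrt (C n * rel_entropy rho sigma).
Proof.
move=> d0 hh hr hc _ hJ b0.
(* This is 4 A^2 N from [optimise_t] with A = slope ln n, the cost of one window, and N = n, the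
   number of windows. *)
exists (fun n => 4 * (slope r J beta * ln n%:R) ^+ 2 * n%:R); split.
  exists (4 * slope r J beta ^+ 2), 2 => n n2.
  have l0 : 0 <= ln (n%:R : R) by rewrite ln_ge0 // ler1n; lia.
  apply/andP; split; first by rewrite mulr_ge0 ?ler0n // mulr_ge0 ?sqr_ge0.
  have -> : ln (n%:R : R) `^ 2 = ln (n%:R : R) ^+ 2 by rewrite -powR_mulrn.
  by rewrite exprMn; move: (ln _) => x; rewrite le_eqVlt; apply/orP; left;
    apply/eqP; ring.
move=> n n2 sigma rho [hrho prho trho]; rewrite /W1.
(* [sup] of the empty set is 0, so no Lipschitz observable has to be exhibited. *)
set S := (X in sup X); have [S0|nS] := pselect (S !=set0); last first.
  have -> : S = set0 by apply/seteqP; split => // x Sx; case: nS; exists x.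
  by rewrite sup0 sqrtr_ge0.
apply: ge_sup => // _ [H [/hermsymmxE hH lH] <-].
rewrite rel_entropyE.
exact: (transport_gaussian d0 hh hr hc hJ b0 n2 prho trho hH lH).
Qed.
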